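(* Consider the manifold $M=[-\pi,\pi]\times\mathbb{T}^1$ with variables $(z,\theta)$, endowed with the warped product metric $g(z,\theta)=dz^2+R(z)^2d\theta^2$. Assume that $R$ is smooth and positive, that $R(z)=R(-z)$, and that $$R(0)=1,\qquad R\big(\tfrac{\pi}{2}\big)=\sqrt5,\qquad R(\pi)=\tfrac{1}{\sqrt2}.$$ Let $\Sigma=\{z=0\}\times\mathbb{T}^1\subset M$. Then there exist $C,c>0$ and sequences $\lambda_j^e\to+\infty$, $\lambda_j^o\to+\infty$ and $\phi_j^e,\phi_j^o\in L^2(M)$ such that, for $\star\in\{e,o\}$, $$(-\Delta_g-(\lambda_j^\star)^2)\phi_j^\star=0,\qquad \|\phi_j^\star\|_{L^2(M)}=1,\qquad \phi_j^\star|_{z=\pm\pi}=0,$$ with $$\partial_\nu\phi_j^e|_\Sigma=0,\quad \|\phi_j^e|_\Sigma\|_{L^2(\Sigma)}\le Ce^{-c\lambda_j^e},\qquad\text{and}\qquad \phi_j^o|_\Sigma=0,\quad \|\partial_\nu\phi_j^o|_\Sigma\|_{L^2(\Sigma)}\le Ce^{-c\lambda_j^o}.$$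
   Context: $\mathbb{T}^1=\mathbb{R}/2\pi\mathbb{Z}$; $\Delta_g$ is the non-positive Laplace-Beltrami operator of $(M,g)$; $\partial_\nu$ is the unit normal derivative to $\Sigma$ (here $\partial_\nu=\partial_z$). *)

(* Defs.v *)
From Stdlib Require Import Reals.
From Coquelicot Require Import Coquelicot.
Open Scope R_scope.

(* Functions on M = [-PI, PI] x (R / 2 PI Z) are represented by functions of
   (z, theta) in R x R; only their values for -PI <= z <= PI are relevant, and
   functions on the circle are 2 PI-periodic functions of theta.  Smoothness
   up to the boundary means having a smooth extension to an open neighbourhood
   (on which [ex_derive_n] / [ex_diff_n] are meaningful two-sided notions). *)

Definition smooth_on_interval (a b : R) (f : R -> R) : Prop :=
  exists (eps : posreal) (F : R -> R),
    (forall x, a - eps < x < b + eps -> forall n : nat, ex_derive_n F n x) /\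
    (forall x, a <= x <= b -> F x = f x).

Definition smooth_on_M (phi : R -> R -> R) : Prop :=
  (forall z theta, - PI <= z <= PI -> phi z (theta + 2 * PI) = phi z theta) /\
  exists (eps : posreal) (F : R -> R -> R),
    (forall z theta, - PI - eps < z < PI + eps ->
       forall n : nat, ex_diff_n F n z theta) /\
    (forall z theta, - PI <= z <= PI -> F z theta = phi z theta).

Definition d_z (f : R -> R -> R) : R -> R -> R := partial_derive 1 0 f.
Definition d_theta (f : R -> R -> R) : R -> R -> R := partial_derive 0 1 f.

(* g = g_zz dz^2 + 2 g_zt dz dtheta + g_tt dtheta^2 *)
Record metric := Metric {
  g_zz : R -> R -> R;
  g_zt : R -> R -> R;
  g_tt : R -> R -> R }.

Definition warped_metric (r : R -> R) : metric :=
  Metric (fun _ _ => 1) (fun _ _ => 0) (fun z _ => r z ^ 2).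

Definition det_g (g : metric) (z theta : R) : R :=
  g_zz g z theta * g_tt g z theta - g_zt g z theta ^ 2.

Definition vol_density (g : metric) (z theta : R) : R := sqrt (det_g g z theta).

(* Delta_g phi = |g|^(-1/2) d_i (|g|^(1/2) g^(ij) d_j phi), where (g^(ij)) is
   the inverse matrix of g; this is the non-positive Laplacian. *)
Definition laplace_beltrami (g : metric) (phi : R -> R -> R) (z theta : R) : R :=
  / vol_density g z theta *
  (d_z (fun x y => vol_density g x y *
          (g_tt g x y / det_g g x y * d_z phi x y
           - g_zt g x y / det_g g x y * d_theta phi x y)) z theta
   + d_theta (fun x y => vol_density g x y *
          (- (g_zt g x y / det_g g x y) * d_z phi x y
           + g_zz g x y / det_g g x y * d_theta phi x y)) z theta).

(* The integrals below are only used for functions that are continuous, so the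
   Riemann integral computes the L^2 norm for the Riemannian measure. *)
Definition L2norm_M (g : metric) (phi : R -> R -> R) : R :=
  sqrt (RInt (fun z =>
          RInt (fun theta => phi z theta ^ 2 * vol_density g z theta)
               0 (2 * PI)) (- PI) PI).

(* Norm on Sigma = {z = 0}, with the length element induced by g. *)
Definition L2norm_Sigma (g : metric) (u : R -> R) : R :=
  sqrt (RInt (fun theta => u theta ^ 2 * sqrt (g_tt g 0 theta)) 0 (2 * PI)).

(* L^2-normalised Dirichlet eigenfunctions, taken in their smooth
   representative.  The equation is imposed in the interior; for functions and
   metrics smooth up to the boundary it then extends to M by continuity. *)
Definition normalized_dirichlet_eigenfunction
    (g : metric) (lambda : R) (phi : R -> R -> R) : Prop :=
  smooth_on_M phi /\
  (forall z theta, - PI < z < PI ->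
     - laplace_beltrami g phi z theta - lambda ^ 2 * phi z theta = 0) /\
  L2norm_M g phi = 1 /\
  (forall theta, phi (- PI) theta = 0 /\ phi PI theta = 0).

(* Main.v *)
Require Import Defs.
From Stdlib Require Import Reals Lra Lia IndefiniteDescription.
From Coquelicot Require Import Coquelicot.
Open Scope R_scope.

(** Separate variables: [u z * cos (k theta)] is an eigenfunction with
    eigenvalue [k ^ 2 nu] as soon as
    [(r u')' = k ^ 2 (1 / r - nu r) u].  The effective potential [1 / r ^ 2]
    equals [1] on the curve [z = 0] and is at most [1 / 4] near [z = PI / 2].
    With an energy [nu <= 1 / 2] the curve therefore lies in a classically
    forbidden region, while oscillation is possible near [PI / 2].

    Modes with such an energy exist ([shooting]).  The initial data at [0] are
    even, [u = 1] and [u' = 0], or odd, [u = 0] and [u' = k].  In polar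
    coordinates of the phase plane [(u, r u' / k)] the angle obeys a scalar
    equation with a globally Lipschitz right-hand side, and [u] vanishes at
    [PI] when the angle there is a multiple of [PI].  At a low energy the angle
    never passes [PI / 2]; at [nu = 1 / 2] it turns by at least [PI] near
    [z = PI / 2] once [k] is large, and it never goes back through a multiple of
    [PI].  The intermediate value theorem, applied to the angle at [PI] as a
    function of [nu], gives [nu <= 1 / 2] with [u PI = 0].  As [nu] also stays
    above a positive constant, the eigenfrequency [k sqrt nu] is comparable to
    [k].  Evenness of [r] gives [u (- PI) = 0].

    These modes are concentrated away from the curve ([mode_growth]).  On an
    interval [[0, d]] where [1 / r ^ 2] exceeds [nu] by a definite amount,
    [u * (r u' / k)] grows exponentially at a rate proportional to [k], and so
    does [u ^ 2].  The squared [L^2] norm of [u] is thus at least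
    [const * k ^ 2 * exp (k d / 16)], while its Cauchy data on the curve have size
    at most [k].  After normalisation the data are exponentially small. *)

(** * Differential inequalities on the line *)

Lemma continuous_eps (f : R -> R) (x : R) :
  continuous f x <->
  (forall eps, 0 < eps ->
     exists d, 0 < d /\ forall y, Rabs (y - x) < d -> Rabs (f y - f x) < eps).
Proof.
  split.
  - intros H eps Heps.
    destruct (proj1 (filterlim_locally f (f x)) H (mkposreal eps Heps)) as [d Hd].
    exists d. split; [apply d|]. intros y Hy. apply Hd. exact Hy.
  - intros H. apply filterlim_locally. intros eps.
    destruct (H eps (cond_pos eps)) as [d [Hd Hy]].
    exists (mkposreal d Hd). intros y Hxy. apply Hy. exact Hxy.
Qed.

Lemma continuity_of_continuous (f : R -> R) :
  (forall x, continuous f x) -> continuity f.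
Proof. intros H x. apply continuity_pt_filterlim, H. Qed.

Lemma is_derive_continuous (f : R -> R) (x l : R) :
  is_derive f x l -> continuous f x.
Proof.
  intros H.
  exact (ex_derive_continuous (V := R_NormedModule) f x (ex_intro _ l H)).
Qed.

(** The eta-expanded derivative is the form in which [auto_derive] leaves its
    equations, where [is_derive_unique] does not rewrite. *)
Lemma Derive_eta (f : R -> R) (x l : R) :
  is_derive f x l -> Derive (fun y : R => f y) x = l.
Proof. exact (is_derive_unique f x l). Qed.

Lemma exp_le (x y : R) : x <= y -> exp x <= exp y.
Proof.
  intros [H | ->]; [left; apply exp_increasing, H | apply Rle_refl].
Qed.

(** Every differential inequality below is integrated through this form of the
    mean value theorem; [df] is the derivative prescribed by an equation rather
    than [Derive f]. *)
Lemma increment_ge (f df : R -> R) (a b c : R) :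
  a <= b ->
  (forall x, a <= x <= b -> is_derive f x (df x)) ->
  (forall x, a <= x <= b -> c <= df x) ->
  c * (b - a) <= f b - f a.
Proof.
  intros Hab Hd Hc.
  destruct (MVT_gen f a b df) as [x [Hx Heq]];
    rewrite ?(Rmin_left a b Hab), ?(Rmax_right a b Hab) in *.
  - intros x Hx. apply Hd. lra.
  - intros x Hx. apply continuity_pt_filterlim.
    apply (is_derive_continuous f x (df x)), Hd, Hx.
  - rewrite Heq. apply Rmult_le_compat_r; [lra | apply Hc, Hx].
Qed.

(** The integrating factor [exp (- k x)] makes [f x * exp (- k x)] nondecreasing. *)
Lemma exp_growth_ge (f df : R -> R) (a b k : R) :
  a <= b ->
  (forall x, a <= x <= b -> is_derive f x (df x)) ->
  (forall x, a <= x <= b -> k * f x <= df x) ->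
  f a * exp (k * (b - a)) <= f b.
Proof.
  intros Hab Hd Hk.
  assert (H := increment_ge (fun x => f x * exp (- k * (x - a)))
    (fun x => (df x - k * f x) * exp (- k * (x - a))) a b 0 Hab).
  simpl in H. rewrite Rminus_diag, !Rmult_0_r, exp_0, Rmult_0_l, Rmult_1_r in H.
  assert (Hm : 0 <= f b * exp (- k * (b - a)) - f a).
  { apply H.
    - intros x Hx. specialize (Hd x Hx). auto_derive.
      + exists (df x). exact Hd.
      + rewrite (Derive_eta f _ _ Hd). unfold Rminus. ring.
    - intros x Hx. apply Rmult_le_pos; [specialize (Hk x Hx); lra|].
      left; apply exp_pos. }
  replace (f b) with (f b * exp (- k * (b - a)) * exp (k * (b - a))).
  - apply Rmult_le_compat_r; [left; apply exp_pos | lra].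
  - rewrite Rmult_assoc, <- exp_plus.
    replace (- k * (b - a) + k * (b - a)) with 0 by ring.
    rewrite exp_0. ring.
Qed.

Lemma exp_growth_le (f df : R -> R) (a b k : R) :
  a <= b ->
  (forall x, a <= x <= b -> is_derive f x (df x)) ->
  (forall x, a <= x <= b -> df x <= k * f x) ->
  f b <= f a * exp (k * (b - a)).
Proof.
  intros Hab Hd Hk.
  enough (- f a * exp (k * (b - a)) <= - f b) by lra.
  apply (exp_growth_ge (fun x => - f x) (fun x => - df x)); [exact Hab| |].
  - intros x Hx. apply (is_derive_opp f), Hd, Hx.
  - intros x Hx. specialize (Hk x Hx). lra.
Qed.

Lemma is_derive_pos_right (f : R -> R) (x l b : R) :
  is_derive f x l -> 0 < l -> x < b -> exists y, x < y < b /\ f x < f y.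
Proof.
  intros Hd Hl Hb.
  apply is_derive_Reals in Hd.
  destruct (Hd (l / 2) ltac:(lra)) as [d Hdd].
  assert (Hd0 := cond_pos d).
  set (h := Rmin (d / 2) ((b - x) / 2)).
  assert (Hh : 0 < h) by (apply Rmin_glb_lt; lra).
  assert (Hh1 : h <= d / 2) by apply Rmin_l.
  assert (Hh2 : h <= (b - x) / 2) by apply Rmin_r.
  exists (x + h). split; [lra|].
  specialize (Hdd h ltac:(lra) ltac:(rewrite Rabs_pos_eq; lra)).
  apply Rabs_def2 in Hdd.
  assert (Hq : 0 < (f (x + h) - f x) / h) by lra.
  assert (Hm := Rmult_lt_0_compat _ _ Hq Hh).
  replace ((f (x + h) - f x) / h * h) with (f (x + h) - f x) in Hm by (field; lra).
  lra.
Qed.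

(** A function that can only cross zero upwards never becomes negative: at the
    last zero before a negative value the derivative would have to be
    nonpositive. *)
Lemma nonneg_of_positive_crossing (f df : R -> R) (a b : R) :
  (forall x, a <= x <= b -> is_derive f x (df x)) ->
  0 <= f a ->
  (forall x, a <= x <= b -> f x = 0 -> 0 < df x) ->
  forall x, a <= x <= b -> 0 <= f x.
Proof.
  intros Hd Ha H0 x Hx.
  destruct (Rle_or_lt 0 (f x)) as [|Hneg]; [assumption|exfalso].
  set (E := fun t => a <= t <= x /\ 0 <= f t).
  destruct (completeness E) as [s [Hub Hlub]].
  { exists x. intros t [Ht _]. lra. }
  { exists a. split; [lra | assumption]. }
  assert (Has : a <= s) by (apply Hub; split; [lra|assumption]).
  assert (Hsx : s <= x) by (apply Hlub; intros t [Ht _]; lra).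
  assert (Hcs : continuous f s) by (apply (is_derive_continuous f s (df s)), Hd; lra).
  assert (Hs : 0 <= f s).
  { destruct (Rle_or_lt 0 (f s)) as [|Hs]; [assumption|exfalso].
    destruct (proj1 (continuous_eps f s) Hcs (- f s) ltac:(lra)) as [d [Hd0 Hc]].
    assert (Hub' : s <= s - d / 2); [|lra].
    apply Hlub. intros t Ht.
    destruct (Rle_or_lt t (s - d / 2)) as [|Hlt]; [assumption|exfalso].
    assert (Hts := Hub t Ht). destruct Ht as [_ Hft].
    specialize (Hc t ltac:(apply Rabs_def1; lra)). apply Rabs_def2 in Hc. lra. }
  assert (Hlt : s < x) by (destruct (Rle_lt_or_eq_dec s x Hsx) as [|He]; [assumption|]; subst; lra).
  assert (Hex : exists t, s < t < x /\ 0 <= f t).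
  { destruct (Rle_lt_or_eq_dec 0 (f s) Hs) as [Hp|Hz].
    - destruct (proj1 (continuous_eps f s) Hcs (f s) Hp) as [d [Hd0 Hc]].
      set (h := Rmin (d / 2) ((x - s) / 2)).
      assert (Hh : 0 < h) by (apply Rmin_glb_lt; lra).
      assert (Hh1 : h <= d / 2) by apply Rmin_l.
      assert (Hh2 : h <= (x - s) / 2) by apply Rmin_r.
      exists (s + h). split; [lra|].
      specialize (Hc (s + h) ltac:(apply Rabs_def1; lra)). apply Rabs_def2 in Hc. lra.
    - destruct (is_derive_pos_right f s (df s) x) as [t [Ht Hft]];
        [apply Hd; lra | apply H0; [lra | congruence] | assumption |].
      exists t. split; [assumption|lra]. }
  destruct Hex as [t [Ht Hft]].
  assert (t <= s) by (apply Hub; split; [lra | assumption]).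
  lra.
Qed.

(** * Global solutions of Lipschitz equations and dependence on the field *)

(** Assumptions on [x' = G t x] under which the solution through any initial
    value exists on the whole line.  Continuity in [t] for each fixed [x]
    suffices, since the Lipschitz bound makes it joint. *)
Record bounded_lipschitz (G : R -> R -> R) (L B : R) : Prop := {
  lip_pos : 0 < L;
  lip_bound : forall t x, Rabs (G t x) <= B;
  lip_ineq : forall t x y, Rabs (G t x - G t y) <= L * Rabs (x - y);
  lip_cont : forall x t, continuous (fun s => G s x) t }.

Lemma continuous_along (G : R -> R -> R) (L B : R) (x : R -> R) (t : R) :
  bounded_lipschitz G L B -> continuous x t ->
  continuous (fun s => G s (x s)) t.
Proof.
  intros HG Hx. apply continuous_eps. intros eps Heps.
  assert (HL := lip_pos _ _ _ HG).
  destruct (proj1 (continuous_eps _ _) Hx (eps / 2 / L)) as [d1 [Hd1 H1]].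
  { apply Rdiv_lt_0_compat; lra. }
  destruct (proj1 (continuous_eps _ _) (lip_cont _ _ _ HG (x t) t) (eps / 2))
    as [d2 [Hd2 H2]]; [lra|].
  exists (Rmin d1 d2). split; [apply Rmin_glb_lt; assumption|].
  intros s Hs.
  specialize (H1 s (Rlt_le_trans _ _ _ Hs (Rmin_l _ _))).
  specialize (H2 s (Rlt_le_trans _ _ _ Hs (Rmin_r _ _))).
  assert (H3 := lip_ineq _ _ _ HG s (x s) (x t)).
  assert (H4 : L * Rabs (x s - x t) < eps / 2).
  { replace (eps / 2) with (L * (eps / 2 / L)) by (field; lra).
    apply Rmult_lt_compat_l; assumption. }
  replace (G s (x s) - G t (x t))
    with ((G s (x s) - G s (x t)) + (G s (x t) - G t (x t))) by ring.
  eapply Rle_lt_trans; [apply Rabs_triang | lra].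
Qed.

Fixpoint picard_iter (G : R -> R -> R) (c : R) (n : nat) (t : R) : R :=
  match n with
  | O => c
  | S m => c + RInt (fun s => G s (picard_iter G c m s)) 0 t
  end.

(** Defining the solution as an explicit limit makes it a function of the
    vector field, so that it can later be studied as a function of a
    parameter of that field. *)
Definition picard_sol (G : R -> R -> R) (c t : R) : R :=
  real (Lim_seq (fun n => picard_iter G c n t)).

Lemma is_derive_primitive (f : R -> R) (t : R) :
  (forall s, continuous f s) -> is_derive (fun u => RInt f 0 u) t (f t).
Proof.
  intros Hf. apply (is_derive_RInt f (fun u => RInt f 0 u) 0); [|apply Hf].
  apply filter_forall. intros u. apply (RInt_correct (V := R_CompleteNormedModule)).
  apply (ex_RInt_continuous (V := R_CompleteNormedModule)). intros z _. apply Hf.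
Qed.

Lemma picard_iter_derive (G : R -> R -> R) (L B c : R) (n : nat) :
  bounded_lipschitz G L B ->
  (forall t, continuous (picard_iter G c n) t) /\
  (forall t, is_derive (picard_iter G c (S n)) t (G t (picard_iter G c n t))).
Proof.
  intros HG.
  assert (Hstep : forall m, (forall t, continuous (picard_iter G c m) t) ->
    forall t, is_derive (picard_iter G c (S m)) t (G t (picard_iter G c m t))).
  { intros m Hm t. simpl.
    replace (G t (picard_iter G c m t)) with (0 + G t (picard_iter G c m t)) by ring.
    apply (is_derive_plus (fun _ => c) (fun u => RInt (fun s => G s (picard_iter G c m s)) 0 u)).
    - apply (is_derive_const (V := R_NormedModule)).
    - apply (is_derive_primitive (fun s => G s (picard_iter G c m s))).
      intros s. apply (continuous_along G L B); [assumption | apply Hm]. }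
  induction n as [|n [IHc IHd]].
  - assert (H0 : forall t, continuous (picard_iter G c 0) t).
    { intros t. simpl. apply (continuous_const (V := R_UniformSpace)). }
    split; [exact H0 | apply Hstep, H0].
  - assert (H1 : forall t, continuous (picard_iter G c (S n)) t).
    { intros t. eapply is_derive_continuous. apply IHd. }
    split; [exact H1 | apply Hstep, H1].
Qed.

Lemma picard_iter_0 (G : R -> R -> R) (c : R) (n : nat) : picard_iter G c n 0 = c.
Proof.
  destruct n; simpl; [reflexivity|].
  rewrite (RInt_point (V := R_CompleteNormedModule)). unfold zero; simpl. ring.
Qed.

(** With the weight [exp (2 L |t|)], integrating from [0] gains a factor
    [1 / 2] over multiplication by the Lipschitz constant [L].  This makes the
    Picard operator a contraction on the whole line at once. *)
Lemma weighted_bound (f df : R -> R) (L K t : R) :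
  0 < L -> 0 <= K -> f 0 = 0 ->
  (forall s, is_derive f s (df s)) ->
  (forall s, Rabs (df s) <= L * K * exp (2 * L * Rabs s)) ->
  Rabs (f t) <= K / 2 * exp (2 * L * Rabs t).
Proof.
  intros HL HK.
  assert (main : forall (g dg : R -> R) u, 0 <= u -> g 0 = 0 ->
    (forall s, is_derive g s (dg s)) ->
    (forall s, Rabs (dg s) <= L * K * exp (2 * L * Rabs s)) ->
    g u <= K / 2 * exp (2 * L * u)).
  { intros g dg u Hu Hg0 Hg Hb.
    assert (H := increment_ge (fun s => K / 2 * exp (2 * L * s) - g s)
      (fun s => L * K * exp (2 * L * s) - dg s) 0 u 0 Hu).
    simpl in H. rewrite Hg0, Rmult_0_r, exp_0 in H.
    enough (0 <= K / 2 * exp (2 * L * u) - g u - (K / 2 * 1 - 0)) by lra.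
    rewrite Rmult_0_l in H. apply H.
    - intros s Hs. specialize (Hg s). auto_derive.
      + exists (dg s). exact Hg.
      + rewrite (Derive_eta g _ _ Hg). field.
    - intros s Hs. specialize (Hb s). rewrite (Rabs_pos_eq s) in Hb by lra.
      assert (H2 := Rle_abs (dg s)). lra. }
  intros Hf0 Hf Hb.
  assert (Hf0' : - f 0 = 0) by (rewrite Hf0; ring).
  assert (Hopp : forall s, is_derive (fun s => f (- s)) s (- df (- s))).
  { intros s. assert (H := Hf (- s)). auto_derive.
    - exists (df (- s)). exact H.
    - rewrite (Derive_eta f _ _ H). ring. }
  assert (Hbopp : forall s, Rabs (- df (- s)) <= L * K * exp (2 * L * Rabs s)).
  { intros s. rewrite Rabs_Ropp, <- (Rabs_Ropp s). apply Hb. }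
  destruct (Rle_or_lt 0 t) as [Ht|Ht].
  - rewrite (Rabs_pos_eq t) by exact Ht. apply Rabs_le. split.
    + enough (- f t <= K / 2 * exp (2 * L * t)) by lra.
      apply (main (fun s => - f s) (fun s => - df s)); try assumption.
      * intros s. apply (is_derive_opp f), Hf.
      * intros s. rewrite Rabs_Ropp. apply Hb.
    + apply (main f df); assumption.
  - rewrite (Rabs_left t) by exact Ht. apply Rabs_le. split.
    + enough (- f (- (- t)) <= K / 2 * exp (2 * L * - t)) by (rewrite Ropp_involutive in H; lra).
      apply (main (fun s => - f (- s)) (fun s => - - df (- s))); try lra.
      * rewrite Ropp_0. lra.
      * intros s. apply (is_derive_opp (fun s => f (- s))), Hopp.
      * intros s. rewrite Rabs_Ropp. apply Hbopp.
    + enough (f (- (- t)) <= K / 2 * exp (2 * L * - t)) by (rewrite Ropp_involutive in H; lra).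
      apply (main (fun s => f (- s)) (fun s => - df (- s))); try lra.
      * rewrite Ropp_0. lra.
      * exact Hopp.
      * exact Hbopp.
Qed.

Lemma picard_contraction (G : R -> R -> R) (L B c K : R) (x1 x2 y1 y2 : R -> R) (t : R) :
  bounded_lipschitz G L B -> 0 <= K ->
  (forall s, Rabs (x1 s - x2 s) <= K * exp (2 * L * Rabs s)) ->
  (forall s, is_derive y1 s (G s (x1 s))) -> y1 0 = c ->
  (forall s, is_derive y2 s (G s (x2 s))) -> y2 0 = c ->
  Rabs (y1 t - y2 t) <= K / 2 * exp (2 * L * Rabs t).
Proof.
  intros HG HK Hx Hy1 Hy10 Hy2 Hy20.
  assert (HL := lip_pos _ _ _ HG).
  apply (weighted_bound (fun s => y1 s - y2 s) (fun s => G s (x1 s) - G s (x2 s)));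
    [assumption | assumption | lra | |].
  - intros s. apply (is_derive_minus y1 y2); [apply Hy1 | apply Hy2].
  - intros s. eapply Rle_trans; [apply (lip_ineq _ _ _ HG)|].
    rewrite Rmult_assoc. apply Rmult_le_compat_l; [lra | apply Hx].
Qed.

Lemma picard_step_bound (G : R -> R -> R) (L B c : R) (n : nat) (t : R) :
  bounded_lipschitz G L B ->
  Rabs (picard_iter G c (S n) t - picard_iter G c n t)
    <= B / L * (/ 2) ^ n * exp (2 * L * Rabs t).
Proof.
  intros HG. assert (HL := lip_pos _ _ _ HG).
  assert (HB : 0 <= B) by (eapply Rle_trans; [apply Rabs_pos | apply (lip_bound _ _ _ HG 0 0)]).
  assert (HBL : 0 <= B / L) by (apply Rdiv_le_0_compat; assumption).
  revert t. induction n as [|n IH]; intros t.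
  - assert (H := weighted_bound (fun s => picard_iter G c 1 s - c) (fun s => G s c) L (B / L) t
                   HL HBL).
    eapply Rle_trans; [apply H|].
    + rewrite picard_iter_0. ring.
    + intros s. replace (G s c) with (G s c - 0) by ring.
      apply (is_derive_minus (picard_iter G c 1) (fun _ => c)).
      * apply (proj2 (picard_iter_derive G L B c 0 HG)).
      * apply (is_derive_const (V := R_NormedModule)).
    + intros s. replace (L * (B / L)) with B by (field; lra).
      rewrite <- (Rmult_1_r (Rabs (G s c))).
      apply Rmult_le_compat; [apply Rabs_pos | lra | apply (lip_bound _ _ _ HG) |].
      rewrite <- exp_0 at 1. apply exp_le.
      apply Rmult_le_pos; [lra | apply Rabs_pos].
    + simpl. assert (He := exp_pos (2 * L * Rabs t)).
      apply Rmult_le_compat_r; lra.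
  - replace (B / L * (/ 2) ^ S n) with ((B / L * (/ 2) ^ n) / 2) by (simpl; field; lra).
    apply (picard_contraction G L B c _ (picard_iter G c (S n)) (picard_iter G c n)).
    + exact HG.
    + apply Rmult_le_pos; [assumption | apply pow_le; lra].
    + exact IH.
    + apply (proj2 (picard_iter_derive G L B c (S n) HG)).
    + apply picard_iter_0.
    + apply (proj2 (picard_iter_derive G L B c n HG)).
    + apply picard_iter_0.
Qed.

(** Not only convergence but the explicit distance to the limit is needed: it
    is what lets the integral equation pass to the limit. *)
Lemma geometric_tail (u : nat -> R) (K : R) :
  (forall n, Rabs (u (S n) - u n) <= K * (/ 2) ^ n) ->
  is_lim_seq u (real (Lim_seq u)) /\
  forall n, Rabs (real (Lim_seq u) - u n) <= 2 * K * (/ 2) ^ n.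
Proof.
  intros Hu.
  assert (Htail : forall n m, Rabs (u (n + m)%nat - u n) <= 2 * K * ((/ 2) ^ n - (/ 2) ^ (n + m))).
  { intros n m. induction m as [|m IH].
    - rewrite Nat.add_0_r, !Rminus_diag, Rabs_R0. lra.
    - rewrite Nat.add_succ_r.
      replace (u (S (n + m)) - u n)
        with ((u (S (n + m)) - u (n + m)%nat) + (u (n + m)%nat - u n)) by ring.
      eapply Rle_trans; [apply Rabs_triang|].
      specialize (Hu (n + m)%nat). simpl. lra. }
  assert (HK : 0 <= K).
  { specialize (Hu 0%nat). simpl in Hu.
    assert (H := Rabs_pos (u 1%nat - u 0%nat)). lra. }
  assert (Hbd : forall n m, Rabs (u (n + m)%nat - u n) <= 2 * K * (/ 2) ^ n).
  { intros n m. eapply Rle_trans; [apply Htail|].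
    apply Rmult_le_compat_l; [lra|].
    assert (0 <= (/ 2) ^ (n + m)) by (apply pow_le; lra). lra. }
  assert (Hgeo : is_lim_seq (fun n => 2 * K * (/ 2) ^ n) 0).
  { replace (Finite 0) with (Rbar_mult (2 * K) 0) by (simpl; f_equal; ring).
    apply is_lim_seq_scal_l, is_lim_seq_geom. rewrite Rabs_pos_eq; lra. }
  assert (Hlim : is_lim_seq u (real (Lim_seq u))).
  { apply Lim_seq_correct', ex_lim_seq_cauchy_corr. intros eps.
    assert (He : 0 < eps / 2) by (assert (H := cond_pos eps); lra).
    destruct (proj2 (is_lim_seq_spec _ _) Hgeo (mkposreal _ He)) as [N HN].
    simpl in HN. exists N.
    assert (HN' := HN N (Nat.le_refl N)). rewrite Rminus_0_r in HN'.
    apply Rabs_def2 in HN'. destruct HN' as [HN' _].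
    intros n m Hn Hm.
    assert (Hn' := Hbd N (n - N)%nat). assert (Hm' := Hbd N (m - N)%nat).
    replace (N + (n - N))%nat with n in Hn' by lia.
    replace (N + (m - N))%nat with m in Hm' by lia.
    replace (u n - u m) with ((u n - u N) + - (u m - u N)) by ring.
    eapply Rle_lt_trans; [apply Rabs_triang|]. rewrite Rabs_Ropp. lra. }
  split; [exact Hlim|].
  intros n.
  assert (Hl : is_lim_seq (fun m => Rabs (u (n + m)%nat - u n)) (Rabs (real (Lim_seq u) - u n))).
  { apply (is_lim_seq_abs _ (Finite (real (Lim_seq u) - u n))).
    apply is_lim_seq_minus'; [|apply is_lim_seq_const].
    apply (is_lim_seq_ext (fun m => u (m + n)%nat)).
    - intros m. f_equal. lia.
    - apply (is_lim_seq_incr_n u n). exact Hlim. }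
  apply (is_lim_seq_le _ _ _ _ (Hbd n) Hl (is_lim_seq_const _)).
Qed.

Lemma picard_sol_close (G : R -> R -> R) (L B c : R) (n : nat) (t : R) :
  bounded_lipschitz G L B ->
  is_lim_seq (fun n => picard_iter G c n t) (picard_sol G c t) /\
  Rabs (picard_sol G c t - picard_iter G c n t)
    <= 2 * (B / L) * (/ 2) ^ n * exp (2 * L * Rabs t).
Proof.
  intros HG.
  destruct (geometric_tail (fun n => picard_iter G c n t) (B / L * exp (2 * L * Rabs t)))
    as [H1 H2].
  - intros m. eapply Rle_trans; [apply (picard_step_bound G L B); assumption|].
    right. ring.
  - split; [exact H1|]. eapply Rle_trans; [apply (H2 n)|]. right. ring.
Qed.

Lemma picard_sol_0 (G : R -> R -> R) (c : R) : picard_sol G c 0 = c.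
Proof.
  unfold picard_sol. rewrite (Lim_seq_ext _ (fun _ => c)).
  - rewrite Lim_seq_const. reflexivity.
  - intros n. apply picard_iter_0.
Qed.

(** All iterates are Lipschitz with the common constant [max |G|], hence so
    is their limit. *)
Lemma picard_sol_continuous (G : R -> R -> R) (L B c t : R) :
  bounded_lipschitz G L B -> continuous (picard_sol G c) t.
Proof.
  intros HG.
  assert (HB : 0 <= B) by (eapply Rle_trans; [apply Rabs_pos | apply (lip_bound _ _ _ HG 0 0)]).
  assert (Hn : forall n a b, a <= b ->
    Rabs (picard_iter G c n b - picard_iter G c n a) <= B * (b - a)).
  { intros n a b Hab. destruct n as [|n].
    - simpl. rewrite Rminus_diag, Rabs_R0. apply Rmult_le_pos; lra.
    - assert (Hd := proj2 (picard_iter_derive G L B c n HG)).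
      assert (Hb : forall x, - B <= G x (picard_iter G c n x) <= B).
      { intros x. apply Rabs_le_between, (lip_bound _ _ _ HG). }
      apply Rabs_le. split.
      + assert (H := increment_ge _ _ a b (- B) Hab (fun x _ => Hd x) (fun x _ => proj1 (Hb x))).
        lra.
      + assert (H := increment_ge (fun x => - picard_iter G c (S n) x)
          (fun x => - G x (picard_iter G c n x)) a b (- B) Hab).
        simpl in H. simpl.
        enough (- B * (b - a) <= - picard_iter G c (S n) b - - picard_iter G c (S n) a)
          by (simpl in *; lra).
        apply H.
        * intros x _. apply (is_derive_opp (picard_iter G c (S n))), Hd.
        * intros x _. specialize (Hb x). lra. }
  assert (Hsol : forall a b, Rabs (picard_sol G c b - picard_sol G c a) <= B * Rabs (b - a)).
  { assert (Hle : forall a b, a <= b ->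
      Rabs (picard_sol G c b - picard_sol G c a) <= B * (b - a)).
    { intros a b Hab.
      assert (Hl : is_lim_seq (fun n => Rabs (picard_iter G c n b - picard_iter G c n a))
                     (Rabs (picard_sol G c b - picard_sol G c a))).
      { apply (is_lim_seq_abs _ (Finite (picard_sol G c b - picard_sol G c a))).
        apply is_lim_seq_minus'; apply (picard_sol_close G L B c 0 _ HG). }
      exact (is_lim_seq_le _ _ _ _ (fun n => Hn n a b Hab) Hl (is_lim_seq_const _)). }
    intros a b. destruct (Rle_or_lt a b) as [H|H].
    - rewrite (Rabs_pos_eq (b - a)) by lra. apply Hle, H.
    - rewrite (Rabs_left (b - a)), Rabs_minus_sym by lra.
      replace (- (b - a)) with (a - b) by ring. apply Hle. lra. }
  apply continuous_eps. intros eps Heps.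
  exists (eps / (B + 1)). split; [apply Rdiv_lt_0_compat; lra|].
  intros y Hy. eapply Rle_lt_trans; [apply Hsol|].
  apply Rle_lt_trans with ((B + 1) * Rabs (y - t)).
  - apply Rmult_le_compat_r; [apply Rabs_pos | lra].
  - replace eps with ((B + 1) * (eps / (B + 1))) by (field; lra).
    apply Rmult_lt_compat_l; lra.
Qed.

(** The primitive [y] of [G s (x s)] built on the limit [x] is also a limit of
    the iterates, by the contraction estimate, so [y = x]. *)
Theorem picard_sol_derive (G : R -> R -> R) (L B c t : R) :
  bounded_lipschitz G L B ->
  is_derive (picard_sol G c) t (G t (picard_sol G c t)).
Proof.
  intros HG.
  assert (HL := lip_pos _ _ _ HG).
  assert (HB : 0 <= B) by (eapply Rle_trans; [apply Rabs_pos | apply (lip_bound _ _ _ HG 0 0)]).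
  assert (HBL : 0 <= B / L) by (apply Rdiv_le_0_compat; assumption).
  set (x := picard_sol G c).
  set (y := fun u => c + RInt (fun s => G s (x s)) 0 u).
  assert (Hy : forall s, is_derive y s (G s (x s))).
  { intros s. unfold y. replace (G s (x s)) with (0 + G s (x s)) by ring.
    apply (is_derive_plus (fun _ => c) (fun u => RInt (fun s => G s (x s)) 0 u)).
    - apply (is_derive_const (V := R_NormedModule)).
    - apply (is_derive_primitive (fun s => G s (x s))). intros u.
      apply (continuous_along G L B); [assumption|].
      apply (picard_sol_continuous G L B); assumption. }
  assert (Hy0 : y 0 = c).
  { unfold y. rewrite (RInt_point (V := R_CompleteNormedModule)). unfold zero; simpl. ring. }
  assert (Hxy : forall s, y s = x s).
  { intros s.
    assert (Hlim : is_lim_seq (fun n => picard_iter G c (S n) s) (y s)).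
    { apply (is_lim_seq_le_le
        (fun n => y s - B / L * exp (2 * L * Rabs s) * (/ 2) ^ n) _
        (fun n => y s + B / L * exp (2 * L * Rabs s) * (/ 2) ^ n)).
      - intros n.
        assert (H' : Rabs (picard_iter G c (S n) s - y s)
                     <= 2 * (B / L) * (/ 2) ^ n / 2 * exp (2 * L * Rabs s)).
        { apply (picard_contraction G L B c _ (picard_iter G c n) x).
          - exact HG.
          - apply Rmult_le_pos; [lra | apply pow_le; lra].
          - intros u. rewrite Rabs_minus_sym. apply (picard_sol_close G L B); assumption.
          - apply (proj2 (picard_iter_derive G L B c n HG)).
          - apply picard_iter_0.
          - exact Hy.
          - exact Hy0. }
        apply Rabs_le_between in H'.
        replace (2 * (B / L) * (/ 2) ^ n / 2 * exp (2 * L * Rabs s))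
          with (B / L * exp (2 * L * Rabs s) * (/ 2) ^ n) in H' by (field; lra).
        lra.
      - replace (Finite (y s)) with (Finite (y s - B / L * exp (2 * L * Rabs s) * 0))
          by (f_equal; ring).
        apply is_lim_seq_minus'; [apply is_lim_seq_const|].
        apply (is_lim_seq_scal_l _ _ (Finite 0)), is_lim_seq_geom. rewrite Rabs_pos_eq; lra.
      - replace (Finite (y s)) with (Finite (y s + B / L * exp (2 * L * Rabs s) * 0))
          by (f_equal; ring).
        apply is_lim_seq_plus'; [apply is_lim_seq_const|].
        apply (is_lim_seq_scal_l _ _ (Finite 0)), is_lim_seq_geom. rewrite Rabs_pos_eq; lra. }
    assert (Hlim2 : is_lim_seq (fun n => picard_iter G c (S n) s) (x s)).
    { apply (is_lim_seq_incr_1 (fun n => picard_iter G c n s)).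
      apply (picard_sol_close G L B c 0); assumption. }
    apply is_lim_seq_unique in Hlim. apply is_lim_seq_unique in Hlim2. congruence. }
  apply (is_derive_ext y); [exact Hxy | apply Hy].
Qed.

(** The squared distance [d] of the two solutions satisfies
    [d' <= 2 L d + 2 eta sqrt d <= (2 L + 1) (d + eta ^ 2)].  With [eta = 0] this
    is uniqueness; with [eta] proportional to the variation of a parameter it
    is continuity in that parameter. *)
Lemma ode_dependence (G1 G2 : R -> R -> R) (x1 x2 : R -> R) (L eta T : R) :
  0 <= L -> 0 <= T ->
  (forall t, 0 <= t <= T -> is_derive x1 t (G1 t (x1 t))) ->
  (forall t, 0 <= t <= T -> is_derive x2 t (G2 t (x2 t))) ->
  x1 0 = x2 0 ->
  (forall t a b, Rabs (G1 t a - G2 t b) <= L * Rabs (a - b) + eta) ->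
  (x1 T - x2 T) ^ 2 <= eta ^ 2 * exp ((2 * L + 1) * T).
Proof.
  intros HL HT H1 H2 H0 HG.
  assert (H := exp_growth_le (fun t => (x1 t - x2 t) ^ 2 + eta ^ 2)
    (fun t => 2 * (x1 t - x2 t) * (G1 t (x1 t) - G2 t (x2 t))) 0 T (2 * L + 1) HT).
  simpl in H. rewrite H0, Rminus_diag, Rminus_0_r in H.
  assert (Hf : (x1 T - x2 T) ^ 2 + eta ^ 2 <= eta ^ 2 * exp ((2 * L + 1) * T)).
  { replace (eta ^ 2 * exp ((2 * L + 1) * T))
      with ((0 * (0 * 1) + eta * (eta * 1)) * exp ((2 * L + 1) * T)) by ring.
    apply H.
    - intros t Ht. specialize (H1 t Ht). specialize (H2 t Ht).
      auto_derive.
      + repeat split; first [exists (G1 t (x1 t)); exact H1 | exists (G2 t (x2 t)); exact H2].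
      + rewrite (Derive_eta x1 _ _ H1),
          (Derive_eta x2 _ _ H2). ring.
    - intros t Ht. specialize (HG t (x1 t) (x2 t)).
      set (d := x1 t - x2 t) in *. set (g := G1 t (x1 t) - G2 t (x2 t)) in *.
      assert (Hdg : d * g <= Rabs d * (L * Rabs d + eta)).
      { eapply Rle_trans; [apply Rle_abs|]. rewrite Rabs_mult.
        apply Rmult_le_compat_l; [apply Rabs_pos | exact HG]. }
      assert (Hsq : Rabs d * Rabs d = d * d).
      { rewrite <- Rabs_mult. apply Rabs_pos_eq. apply Rle_0_sqr. }
      assert (Ham : 0 <= (Rabs d - eta) * (Rabs d - eta)) by apply Rle_0_sqr.
      assert (Heta : 0 <= L * (eta * eta)) by (apply Rmult_le_pos; [lra | apply Rle_0_sqr]).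
      nra. }
  assert (0 <= eta ^ 2) by apply pow2_ge_0. lra.
Qed.

(** * Smoothness of solutions and of separated products *)

(** Differentiability of order [n] on a set, peeling off the innermost
    derivative first; [ex_derive_n] peels off the outermost one, which does not
    fit induction on products. *)
Fixpoint diff_on (D : R -> Prop) (n : nat) (f : R -> R) : Prop :=
  match n with
  | O => True
  | S m => (forall x, D x -> ex_derive f x) /\ diff_on D m (Derive f)
  end.

Definition smooth_on (D : R -> Prop) (f : R -> R) : Prop := forall n, diff_on D n f.

Lemma diff_on_ext (D : R -> Prop) (n : nat) (f g : R -> R) :
  open D -> (forall x, D x -> f x = g x) -> diff_on D n f -> diff_on D n g.
Proof.
  intros HD. revert f g. induction n as [|n IH]; intros f g Hfg; simpl; [easy|].
  assert (Hloc : forall x, D x -> locally x (fun y => f y = g y)).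
  { intros x Hx. apply (filter_imp D); [exact Hfg | apply HD, Hx]. }
  intros [Hd Hn]. split.
  - intros x Hx. apply (ex_derive_ext_loc f); [apply Hloc, Hx | apply Hd, Hx].
  - apply (IH (Derive f)); [|exact Hn]. intros x Hx. apply Derive_ext_loc, Hloc, Hx.
Qed.

Lemma diff_on_pred (D : R -> Prop) (n : nat) (f : R -> R) :
  diff_on D (S n) f -> diff_on D n f.
Proof.
  revert f. induction n as [|n IH]; intros f [Hd Hn]; [exact I|].
  split; [exact Hd | apply IH, Hn].
Qed.

Lemma diff_on_step (D : R -> Prop) (n : nat) (f df : R -> R) :
  open D -> (forall x, D x -> is_derive f x (df x)) ->
  diff_on D n df -> diff_on D (S n) f.
Proof.
  intros HD Hf Hn. split.
  - intros x Hx. exists (df x). apply Hf, Hx.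
  - apply (diff_on_ext D n df); [exact HD | | exact Hn].
    intros x Hx. symmetry. apply is_derive_unique, Hf, Hx.
Qed.

Lemma diff_on_const (D : R -> Prop) (n : nat) (c : R) :
  open D -> diff_on D n (fun _ => c).
Proof.
  intros HD. revert c. induction n as [|n IH]; intros c; [exact I|].
  apply (diff_on_step D n _ (fun _ => 0)); [exact HD | | apply IH].
  intros x _. apply (is_derive_const (V := R_NormedModule)).
Qed.

Lemma diff_on_plus (D : R -> Prop) (n : nat) (f g : R -> R) :
  open D -> diff_on D n f -> diff_on D n g -> diff_on D n (fun x => f x + g x).
Proof.
  intros HD. revert f g. induction n as [|n IH]; intros f g; [easy|].
  intros [Hf Hf'] [Hg Hg'].
  apply (diff_on_step D n _ (fun x => Derive f x + Derive g x)); [exact HD | |].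
  - intros x Hx. apply (is_derive_plus f g); apply Derive_correct; auto.
  - apply IH; assumption.
Qed.

Lemma diff_on_mult (D : R -> Prop) (n : nat) (f g : R -> R) :
  open D -> diff_on D n f -> diff_on D n g -> diff_on D n (fun x => f x * g x).
Proof.
  intros HD. revert f g. induction n as [|n IH]; intros f g; [easy|].
  intros Hf Hg. assert (Hfp := diff_on_pred D n f Hf). assert (Hgp := diff_on_pred D n g Hg).
  destruct Hf as [Hf Hf']. destruct Hg as [Hg Hg'].
  apply (diff_on_step D n _ (fun x => Derive f x * g x + f x * Derive g x)); [exact HD | |].
  - intros x Hx. apply (is_derive_mult f g); [| | exact Rmult_comm];
      apply Derive_correct; auto.
  - apply diff_on_plus; [exact HD | |]; apply IH; assumption.
Qed.

Lemma diff_on_inv (D : R -> Prop) (n : nat) (f : R -> R) :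
  open D -> (forall x, D x -> f x <> 0) -> diff_on D n f -> diff_on D n (fun x => / f x).
Proof.
  intros HD Hnz. induction n as [|n IH]; [easy|].
  intros Hf. assert (Hi := IH (diff_on_pred D n f Hf)).
  destruct Hf as [Hf Hf'].
  apply (diff_on_step D n _ (fun x => (-1 * Derive f x) * (/ f x * / f x))); [exact HD | |].
  - intros x Hx.
    replace (-1 * Derive f x * (/ f x * / f x)) with (- Derive f x / f x ^ 2)
      by (field; apply Hnz, Hx).
    apply is_derive_inv; [apply Derive_correct; auto | apply Hnz, Hx].
  - apply diff_on_mult; [exact HD | |].
    + apply diff_on_mult; [exact HD | apply diff_on_const, HD | exact Hf'].
    + apply diff_on_mult; assumption.
Qed.

Lemma smooth_on_of_ex_derive_n (D : R -> Prop) (f : R -> R) :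
  (forall x, D x -> forall n, ex_derive_n f n x) -> smooth_on D f.
Proof.
  intros H n. revert f H. induction n as [|n IH]; intros f H; [exact I|].
  split; [intros x Hx; apply (H x Hx 1%nat)|].
  apply IH. intros x Hx m. destruct m as [|m]; [exact I|].
  apply (ex_derive_ext (Derive_n f (S m))); [|apply (H x Hx (S (S m)))].
  intros t. rewrite <- (Nat.add_1_r m). symmetry. apply (Derive_n_comp f m 1).
Qed.

(** Bootstrapping: the right-hand sides gain one derivative at each turn. *)
Lemma diff_on_system (D : R -> Prop) (u v p q : R -> R) :
  open D -> smooth_on D p -> smooth_on D q ->
  (forall x, D x -> is_derive u x (p x * v x)) ->
  (forall x, D x -> is_derive v x (q x * u x)) ->
  smooth_on D u.
Proof.
  intros HD Hp Hq Hu Hv.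
  enough (H : forall n, diff_on D n u /\ diff_on D n v) by (intros n; apply H).
  induction n as [|n [IHu IHv]]; [easy|].
  split; eapply diff_on_step; [exact HD | exact Hu | | exact HD | exact Hv |];
    apply diff_on_mult; auto.
Qed.

Lemma diff_on_derive (D : R -> Prop) (n : nat) (f : R -> R) :
  diff_on D (S n) f -> diff_on D n (Derive f).
Proof. intros [_ H]. exact H. Qed.

(** Both partial derivatives of a product in separated variables are again of
    that form.  Order [S n] is asked of each factor because order [0] of
    [ex_diff_n] already includes continuity. *)
Lemma ex_diff_n_prod (D E : R -> Prop) (n : nat) (f g : R -> R) (x y : R) :
  D x -> E y -> diff_on D (S n) f -> diff_on E (S n) g ->
  ex_diff_n (fun u v => f u * g v) n x y.
Proof.
  intros Hx Hy. revert f g. induction n as [|n IH]; intros f g Hf Hg.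
  - split; [|exact I]. apply continuity_2d_pt_mult.
    + apply (continuity_1d_2d_pt_comp f (fun u _ => u)); [|apply continuity_2d_pt_id1].
      apply continuity_pt_filterlim, (ex_derive_continuous (V := R_NormedModule)).
      apply Hf, Hx.
    + apply (continuity_1d_2d_pt_comp g (fun _ v => v)); [|apply continuity_2d_pt_id2].
      apply continuity_pt_filterlim, (ex_derive_continuous (V := R_NormedModule)).
      apply Hg, Hy.
  - assert (Hc := IH f g (diff_on_pred _ _ _ Hf) (diff_on_pred _ _ _ Hg)).
    assert (Hex : ex_derive f x) by (apply Hf, Hx).
    assert (Hey : ex_derive g y) by (apply Hg, Hy).
    assert (Hext : forall h1 h2 : R -> R -> R, (forall u v, h1 u v = h2 u v) ->
              ex_diff_n h1 n x y -> ex_diff_n h2 n x y).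
    { intros h1 h2 Hh. apply ex_diff_n_ext_loc. exists (mkposreal 1 Rlt_0_1). auto. }
    simpl. repeat split.
    + (* continuity is the first component of [ex_diff_n] at every order *)
      destruct n; apply Hc.
    + auto_derive. exact Hex.
    + auto_derive. exact Hey.
    + apply (Hext (fun u v => Derive f u * g v)).
      * intros u v. symmetry. apply (Derive_scal_l f (g v) u).
      * apply IH; [apply diff_on_derive, Hf | apply diff_on_pred, Hg].
    + apply (Hext (fun u v => f u * Derive g v)).
      * intros u v. symmetry. apply (Derive_scal g (f u) v).
      * apply IH; [apply diff_on_pred, Hf | apply diff_on_derive, Hg].
Qed.

Lemma is_derive_cos_freq (k x : R) :
  is_derive (fun t => cos (k * t)) x (- k * sin (k * x)).
Proof. auto_derive; [exact I | ring]. Qed.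

Lemma is_derive_sin_freq (k x : R) :
  is_derive (fun t => sin (k * t)) x (k * cos (k * x)).
Proof. auto_derive; [exact I | ring]. Qed.

Lemma smooth_cos_freq (k : R) : smooth_on (fun _ => True) (fun t => cos (k * t)).
Proof.
  assert (Hc : forall c, smooth_on (fun _ => True) (fun _ : R => c))
    by (intros c n; apply diff_on_const, open_true).
  apply (diff_on_system _ _ (fun t => sin (k * t)) (fun _ => - k) (fun _ => k));
    [apply open_true | apply Hc | apply Hc | |]; intros x _.
  - apply is_derive_cos_freq.
  - apply is_derive_sin_freq.
Qed.

(** * Even smooth prolongation of the radius *)

(** The radius of revolution, prolonged to the whole line so that the equations
    below have global solutions; smoothness is kept on a neighbourhood of
    [[- PI, PI]]. *)
Record even_radius (F : R -> R) (b m M : R) : Prop := {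
  radius_b : PI < b;
  radius_m : 0 < m;
  radius_bounds : forall x, m <= F x <= M;
  radius_cont : forall x, continuous F x;
  radius_even : forall x, F (- x) = F x;
  radius_smooth : smooth_on (fun x => - b < x < b) F }.

Lemma open_between (a b : R) : open (fun x : R => a < x < b).
Proof. apply (open_and (fun x => a < x)); [apply open_gt | apply open_lt]. Qed.

Lemma locally_of_interval (a b x : R) (P : R -> Prop) :
  a < x < b -> (forall y, a < y < b -> P y) -> locally x P.
Proof.
  intros Hx HP. apply (filter_imp (fun y => a < y < b)); [exact HP|].
  apply (open_between a b), Hx.
Qed.

(** A smooth extension [E] of [r] beyond [PI] need not match, by symmetry, the
    one beyond [- PI].  Taking [E (|x|)] repairs this: near [0] it is still [r],
    because [r] itself is even, so no singularity appears.  Freezing the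
    argument at [b] makes the result bounded and keeps it positive. *)
Lemma radius_extension (r : R -> R) :
  smooth_on_interval (- PI) PI r ->
  (forall z, - PI <= z <= PI -> 0 < r z) ->
  (forall z, - PI <= z <= PI -> r z = r (- z)) ->
  exists (F : R -> R) (b m M : R),
    even_radius F b m M /\ (forall z, - PI <= z <= PI -> F z = r z).
Proof.
  intros [eps [E [HE HEr]]] Hpos Heven.
  assert (Hpi := PI_RGT_0). assert (Heps := cond_pos eps).
  assert (HEc : forall x, - PI - eps < x < PI + eps -> continuous E x).
  { intros x Hx. apply (ex_derive_continuous (V := R_NormedModule)), (HE x Hx 1%nat). }
  destruct (proj1 (continuous_eps E PI) (HEc PI ltac:(lra)) (E PI)) as [d [Hd HEd]].
  { rewrite HEr by lra. apply Hpos. lra. }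
  set (h := Rmin (eps / 2) (d / 2)).
  assert (Hh : 0 < h) by (apply Rmin_glb_lt; lra).
  assert (Hh1 : h <= eps / 2) by apply Rmin_l.
  assert (Hh2 : h <= d / 2) by apply Rmin_r.
  set (b := PI + h). assert (Hb : PI < b) by (unfold b; lra).
  set (clamp := fun x => Rmin (Rabs x) b).
  assert (Hcl : forall x, 0 <= clamp x <= b).
  { intros x. split; [apply Rmin_glb; [apply Rabs_pos | lra] | apply Rmin_r]. }
  assert (Hin : forall x, - b <= x <= b -> clamp x = Rabs x).
  { intros x Hx. apply Rmin_left, Rabs_le, Hx. }
  assert (HEpos : forall x, 0 <= x <= b -> 0 < E x).
  { intros x Hx. destruct (Rle_or_lt x PI) as [Hle|Hlt].
    - rewrite HEr by lra. apply Hpos. lra.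
    - specialize (HEd x ltac:(unfold b in Hx; apply Rabs_def1; lra)).
      apply Rabs_def2 in HEd. lra. }
  assert (HEcont : forall x, 0 <= x <= b -> continuity_pt E x).
  { intros x Hx. apply continuity_pt_filterlim, HEc. unfold b in Hx. lra. }
  destruct (continuity_ab_min E 0 b ltac:(lra) HEcont) as [xm [Hxm Hxm0]].
  destruct (continuity_ab_maj E 0 b ltac:(lra) HEcont) as [xM [HxM HxM0]].
  assert (Hclc : forall x, continuous clamp x).
  { intros x. apply continuous_eps. intros e He. exists e. split; [exact He|].
    intros y Hy. eapply Rle_lt_trans; [|exact Hy].
    unfold clamp, Rmin, Rabs.
    repeat destruct Rle_dec; repeat destruct Rcase_abs; lra. }
  assert (HFE : forall y, - PI < y < b -> E (clamp y) = E y).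
  { intros y Hy. rewrite Hin by lra. unfold Rabs. destruct (Rcase_abs y); [|reflexivity].
    rewrite !HEr by lra. symmetry. apply Heven. lra. }
  exists (fun x => E (clamp x)), b, (E xm), (E xM).
  split; [constructor|].
  - exact Hb.
  - apply HEpos, Hxm0.
  - intros x. split; [apply Hxm, Hcl | apply HxM, Hcl].
  - intros x. apply (continuous_comp clamp E); [apply Hclc|].
    apply continuity_pt_filterlim, HEcont, Hcl.
  - intros x. unfold clamp. rewrite Rabs_Ropp. reflexivity.
  - apply smooth_on_of_ex_derive_n. intros x Hx n.
    destruct (Rlt_or_le (- PI) x) as [Hgt|Hle].
    + apply (ex_derive_n_ext_loc E).
      * apply (locally_of_interval (- PI) b); [lra|]. intros y Hy. symmetry. apply HFE, Hy.
      * apply HE. unfold b in Hx. lra.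
    + (* to the left of [0] the extension is the mirror image of [E] *)
      apply (ex_derive_n_ext_loc (fun y => E (- y))).
      * apply (locally_of_interval (- b) 0); [lra|]. intros y Hy.
        rewrite Hin by lra. rewrite Rabs_left by lra. reflexivity.
      * apply ex_derive_n_comp_opp.
        apply (locally_of_interval 0 b); [lra|]. intros y Hy k _.
        apply HE. unfold b in Hy. lra.
  - intros z Hz. destruct (Rle_lt_or_eq_dec (- PI) z (proj1 Hz)) as [Hlt|Heq].
    + rewrite HFE by lra. apply HEr, Hz.
    + subst z. rewrite Hin by lra. rewrite Rabs_Ropp, Rabs_pos_eq by lra.
      rewrite HEr by lra. rewrite (Heven (- PI)) by lra. f_equal. ring.
Qed.

(** * Radial modes in polar coordinates *)

(** The radial equation with angular frequency [k] and eigenvalue [k ^ 2 nu] is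
    [(F u')' = k ^ 2 (1 / F - nu F) u]: oscillation takes place where this
    quantity is negative, exponential behaviour where it is positive. *)
Definition potential (F : R -> R) (nu z : R) : R := / F z - nu * F z.

(** The radial equation as a first order system, with [v = F u' / k] scaled so
    that both right-hand sides carry the same factor [k]. *)
Definition mode (F : R -> R) (k nu : R) (u v : R -> R) : Prop :=
  (forall z, is_derive u z (k * / F z * v z)) /\
  (forall z, is_derive v z (k * potential F nu z * u z)).

(** The equation of the angle [x] in polar coordinates [u = rho sin x],
    [v = rho cos x]. *)
Definition prufer (F : R -> R) (k nu t x : R) : R :=
  k * (/ F t * cos x ^ 2 - potential F nu t * sin x ^ 2).

Definition angle (F : R -> R) (k x0 nu : R) : R -> R := picard_sol (prufer F k nu) x0.

Lemma cos_sqr (x : R) : cos x ^ 2 = 1 - sin x ^ 2.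
Proof. rewrite <- !Rsqr_pow2. apply cos2. Qed.

Lemma sin_sqr_bounds (x : R) : 0 <= sin x ^ 2 <= 1.
Proof.
  assert (H := cos_sqr x). assert (H1 := pow2_ge_0 (cos x)).
  split; [apply pow2_ge_0 | lra].
Qed.

Lemma sin_sqr_lipschitz (x y : R) : Rabs (sin x ^ 2 - sin y ^ 2) <= Rabs (x - y).
Proof.
  destruct (MVT_gen (fun t => sin t ^ 2) y x (fun t => sin (2 * t))) as [t [_ Ht]].
  - intros t _. auto_derive; [exact I|]. rewrite sin_2a. ring.
  - intros t _. apply continuity_pt_filterlim, (ex_derive_continuous (V := R_NormedModule)).
    auto_derive. exact I.
  - simpl in *. rewrite Ht, Rabs_mult.
    rewrite <- (Rmult_1_l (Rabs (x - y))) at 2.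
    apply Rmult_le_compat_r; [apply Rabs_pos|]. apply Rabs_le, SIN_bound.
Qed.

Lemma radius_inv_bounds (F : R -> R) (b m M z : R) :
  even_radius F b m M -> 0 < / M <= / F z /\ / F z <= / m /\ 0 < F z.
Proof.
  intros HF. assert (Hm := radius_m _ _ _ _ HF). assert (Hb := radius_bounds _ _ _ _ HF z).
  split; [split|split].
  - apply Rinv_0_lt_compat. lra.
  - apply Rinv_le_contravar; lra.
  - apply Rinv_le_contravar; lra.
  - lra.
Qed.

Lemma continuous_potential (F : R -> R) (b m M nu z : R) :
  even_radius F b m M -> continuous (fun z => / F z) z /\ continuous (potential F nu) z.
Proof.
  intros HF. destruct (radius_inv_bounds F b m M z HF) as [_ [_ HFz]].
  assert (Hc := radius_cont _ _ _ _ HF z).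
  assert (Hi : continuous (fun z => / F z) z).
  { apply continuity_pt_filterlim, continuity_pt_inv; [apply continuity_pt_filterlim, Hc | lra]. }
  split; [exact Hi|].
  apply (continuous_minus (fun z => / F z) (fun z => nu * F z)); [exact Hi|].
  apply (continuous_scal_r nu F), Hc.
Qed.

Lemma prufer_slope_bound (F : R -> R) (b m M nu t : R) :
  even_radius F b m M -> Rabs (2 * / F t - nu * F t) <= 2 / m + Rabs nu * M.
Proof.
  intros HF. destruct (radius_inv_bounds F b m M t HF) as [[HiM HiF] [Him HFt]].
  assert (Hb := radius_bounds _ _ _ _ HF t).
  eapply Rle_trans; [apply Rabs_triang|]. rewrite Rabs_Ropp, !Rabs_mult.
  rewrite (Rabs_pos_eq 2), (Rabs_pos_eq (/ F t)), (Rabs_pos_eq (F t)) by lra.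
  apply Rplus_le_compat; [unfold Rdiv; lra|].
  apply Rmult_le_compat_l; [apply Rabs_pos | lra].
Qed.

Lemma prufer_diff (F : R -> R) (b m M k nu nu' t x y : R) :
  even_radius F b m M -> 0 < k ->
  Rabs (prufer F k nu t x - prufer F k nu' t y)
    <= k * (2 / m + Rabs nu * M) * Rabs (x - y) + k * M * Rabs (nu - nu').
Proof.
  intros HF Hk. destruct (radius_inv_bounds F b m M t HF) as [[HiM HiF] [Him HFt]].
  assert (Hb := radius_bounds _ _ _ _ HF t).
  assert (Hs := sin_sqr_lipschitz x y). assert (Hy := sin_sqr_bounds y).
  unfold prufer, potential. rewrite !cos_sqr.
  replace (k * (/ F t * (1 - sin x ^ 2) - (/ F t - nu * F t) * sin x ^ 2) -
           k * (/ F t * (1 - sin y ^ 2) - (/ F t - nu' * F t) * sin y ^ 2))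
    with (- (k * (2 * / F t - nu * F t) * (sin x ^ 2 - sin y ^ 2))
          + k * F t * (nu - nu') * sin y ^ 2) by ring.
  eapply Rle_trans; [apply Rabs_triang|]. rewrite Rabs_Ropp.
  apply Rplus_le_compat.
  - rewrite !Rabs_mult, (Rabs_pos_eq k) by lra.
    apply Rmult_le_compat; [| apply Rabs_pos | | exact Hs].
    + apply Rmult_le_pos; [lra | apply Rabs_pos].
    + apply Rmult_le_compat_l; [lra | apply (prufer_slope_bound F b m M nu t HF)].
  - rewrite !Rabs_mult, (Rabs_pos_eq k), (Rabs_pos_eq (F t)), (Rabs_pos_eq (sin y ^ 2)) by lra.
    rewrite <- (Rmult_1_r (k * M * Rabs (nu - nu'))).
    apply Rmult_le_compat; [| lra | | lra].
    + apply Rmult_le_pos; [nra | apply Rabs_pos].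
    + apply Rmult_le_compat_r; [apply Rabs_pos|]. apply Rmult_le_compat_l; lra.
Qed.

Lemma prufer_lipschitz (F : R -> R) (b m M k nu : R) :
  even_radius F b m M -> 0 < k ->
  bounded_lipschitz (prufer F k nu) (k * (2 / m + Rabs nu * M))
    (k * / m + k * (2 / m + Rabs nu * M)).
Proof.
  intros HF Hk.
  assert (Hm := radius_m _ _ _ _ HF). assert (HmM := radius_bounds _ _ _ _ HF 0).
  assert (HK : 0 < 2 / m + Rabs nu * M).
  { assert (0 < 2 / m) by (apply Rdiv_lt_0_compat; lra).
    assert (0 <= Rabs nu * M) by (apply Rmult_le_pos; [apply Rabs_pos | lra]). lra. }
  assert (HL : 0 < k * (2 / m + Rabs nu * M)) by (apply Rmult_lt_0_compat; assumption).
  constructor.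
  - exact HL.
  - intros t x. destruct (radius_inv_bounds F b m M t HF) as [[HiM HiF] [Him HFt]].
    assert (Hy := sin_sqr_bounds x).
    unfold prufer, potential. rewrite cos_sqr.
    replace (k * (/ F t * (1 - sin x ^ 2) - (/ F t - nu * F t) * sin x ^ 2))
      with (k * / F t + - (k * (2 * / F t - nu * F t) * sin x ^ 2)) by ring.
    eapply Rle_trans; [apply Rabs_triang|]. rewrite Rabs_Ropp.
    apply Rplus_le_compat.
    + rewrite Rabs_pos_eq by (apply Rmult_le_pos; lra). apply Rmult_le_compat_l; lra.
    + rewrite !Rabs_mult, (Rabs_pos_eq k), (Rabs_pos_eq (sin x ^ 2)) by lra.
      rewrite <- (Rmult_1_r (k * (2 / m + Rabs nu * M))).
      apply Rmult_le_compat; [apply Rmult_le_pos; [lra | apply Rabs_pos] | lra | | lra].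
      apply Rmult_le_compat_l; [lra | apply (prufer_slope_bound F b m M nu t HF)].
  - intros t x y. eapply Rle_trans; [apply (prufer_diff F b m M k nu nu t x y HF Hk)|].
    rewrite (Rminus_diag nu), Rabs_R0. lra.
  - intros x t. destruct (continuous_potential F b m M nu t HF) as [Hp Hq].
    apply (continuous_scal_r k (fun s => / F s * cos x ^ 2 - potential F nu s * sin x ^ 2)).
    apply (continuous_minus (fun s => / F s * cos x ^ 2) (fun s => potential F nu s * sin x ^ 2)).
    + apply (continuous_scal_l (fun s => / F s) (cos x ^ 2)), Hp.
    + apply (continuous_scal_l (potential F nu) (sin x ^ 2)), Hq.
Qed.

Lemma angle_derive (F : R -> R) (b m M k x0 nu t : R) :
  even_radius F b m M -> 0 < k ->
  is_derive (angle F k x0 nu) t (prufer F k nu t (angle F k x0 nu t)).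
Proof. intros HF Hk. eapply picard_sol_derive, prufer_lipschitz; eassumption. Qed.

Lemma angle_0 (F : R -> R) (k x0 nu : R) : angle F k x0 nu 0 = x0.
Proof. apply picard_sol_0. Qed.

Lemma angle_continuous_nu (F : R -> R) (b m M k x0 T nu : R) :
  even_radius F b m M -> 0 < k -> 0 <= T ->
  continuous (fun nu => angle F k x0 nu T) nu.
Proof.
  intros HF Hk HT.
  assert (HmM := radius_bounds _ _ _ _ HF 0). assert (Hm := radius_m _ _ _ _ HF).
  assert (HL := lip_pos _ _ _ (prufer_lipschitz F b m M k nu HF Hk)).
  set (L := k * (2 / m + Rabs nu * M)) in *.
  set (E := exp ((2 * L + 1) * T)).
  assert (HE : 1 <= E).
  { unfold E. rewrite <- exp_0 at 1. apply exp_le. apply Rmult_le_pos; lra. }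
  assert (HkM : 0 < k * M) by (apply Rmult_lt_0_compat; lra).
  apply continuous_eps. intros eps Heps.
  exists (eps / (k * M * E)). split.
  { apply Rdiv_lt_0_compat; [exact Heps|]. apply Rmult_lt_0_compat; lra. }
  intros nu' Hnu'. rewrite Rabs_minus_sym in Hnu'.
  set (eta := k * M * Rabs (nu - nu')).
  assert (Heta : 0 <= eta) by (apply Rmult_le_pos; [lra | apply Rabs_pos]).
  assert (H : (angle F k x0 nu T - angle F k x0 nu' T) ^ 2 <= eta ^ 2 * E).
  { apply (ode_dependence (prufer F k nu) (prufer F k nu')); try lra.
    - intros t _. apply (angle_derive F b m M); assumption.
    - intros t _. apply (angle_derive F b m M); assumption.
    - rewrite !angle_0. reflexivity.
    - intros t a c. apply (prufer_diff F b m M); assumption. }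
  assert (HetaE : eta * E < eps).
  { unfold eta. replace eps with (k * M * (eps / (k * M * E)) * E)
      by (field; split; [lra | split; lra]).
    apply Rmult_lt_compat_r; [lra|]. apply Rmult_lt_compat_l; lra. }
  rewrite Rabs_minus_sym. eapply Rle_lt_trans; [|exact HetaE].
  rewrite <- (Rabs_pos_eq (eta * E)) by (apply Rmult_le_pos; lra).
  apply Rsqr_le_abs_0. rewrite !Rsqr_pow2.
  rewrite Rpow_mult_distr. eapply Rle_trans; [exact H|].
  apply Rmult_le_compat_l; [apply pow2_ge_0|]. nra.
Qed.

(** The vector field is even in [t], so both sides solve the same initial value
    problem.  The condition on [x0] holds for [0] and [PI / 2], the odd and
    the even initial data. *)
Lemma angle_reflect (F : R -> R) (b m M k x0 nu z : R) :
  even_radius F b m M -> 0 < k -> 0 <= z ->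
  (forall x, sin (2 * x0 - x) ^ 2 = sin x ^ 2) ->
  angle F k x0 nu (- z) = 2 * x0 - angle F k x0 nu z.
Proof.
  intros HF Hk Hz Hsym.
  assert (HL := lip_pos _ _ _ (prufer_lipschitz F b m M k nu HF Hk)).
  assert (Hd := fun t => angle_derive F b m M k x0 nu t HF Hk).
  assert (H : (angle F k x0 nu z - (2 * x0 - angle F k x0 nu (- z))) ^ 2
              <= 0 ^ 2 * exp ((2 * (k * (2 / m + Rabs nu * M)) + 1) * z)).
  { apply (ode_dependence (prufer F k nu) (prufer F k nu) (angle F k x0 nu)
             (fun t => 2 * x0 - angle F k x0 nu (- t))); try lra.
    - intros t _. apply Hd.
    - intros t _. assert (Hdt := Hd (- t)).
      replace (prufer F k nu t (2 * x0 - angle F k x0 nu (- t)))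
        with (prufer F k nu (- t) (angle F k x0 nu (- t))).
      + auto_derive.
        * eexists. exact Hdt.
        * rewrite (Derive_eta _ _ _ Hdt). ring.
      + unfold prufer, potential. rewrite !cos_sqr, Hsym, (radius_even _ _ _ _ HF). reflexivity.
    - rewrite Ropp_0, angle_0. ring.
    - intros t a c.
      eapply Rle_trans; [apply (lip_ineq _ _ _ (prufer_lipschitz F b m M k nu HF Hk))|].
      lra. }
  rewrite pow_i, Rmult_0_l in H by lia.
  assert (H' := pow2_ge_0 (angle F k x0 nu z - (2 * x0 - angle F k x0 nu (- z)))).
  assert (H0 : (angle F k x0 nu z - (2 * x0 - angle F k x0 nu (- z))) ^ 2 = 0) by lra.
  rewrite <- Rsqr_pow2 in H0. apply Rsqr_0_uniq in H0. lra.
Qed.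

(** At a multiple of [PI] the angle moves upwards, at speed [k / F]. *)
Lemma angle_stays_above (F : R -> R) (b m M k x0 nu a c T : R) :
  even_radius F b m M -> 0 < k -> sin c = 0 ->
  c <= angle F k x0 nu a ->
  forall z, a <= z <= T -> c <= angle F k x0 nu z.
Proof.
  intros HF Hk Hc Ha z Hz.
  enough (0 <= angle F k x0 nu z - c) by lra.
  apply (nonneg_of_positive_crossing (fun z => angle F k x0 nu z - c)
    (fun z => prufer F k nu z (angle F k x0 nu z)) a T); [| lra | | exact Hz].
  - intros t _. rewrite <- (Rminus_0_r (prufer _ _ _ _ _)).
    apply (is_derive_minus (angle F k x0 nu) (fun _ => c));
      [apply (angle_derive F b m M); assumption | apply (is_derive_const (V := R_NormedModule))].
  - intros t _ H. replace (angle F k x0 nu t) with c by lra.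
    destruct (radius_inv_bounds F b m M t HF) as [HiM _].
    unfold prufer. rewrite cos_sqr, Hc.
    replace (k * (/ F t * (1 - 0 ^ 2) - potential F nu t * 0 ^ 2)) with (k * / F t) by ring.
    apply Rmult_lt_0_compat; lra.
Qed.

(** At an odd multiple of [PI / 2] the angle moves downwards wherever the
    potential is positive: solutions do not turn inside a barrier. *)
Lemma angle_stays_below (F : R -> R) (b m M k x0 nu a c T : R) :
  even_radius F b m M -> 0 < k -> cos c = 0 ->
  (forall z, a <= z <= T -> 0 < potential F nu z) ->
  angle F k x0 nu a <= c ->
  forall z, a <= z <= T -> angle F k x0 nu z <= c.
Proof.
  intros HF Hk Hc Hw Ha z Hz.
  enough (0 <= c - angle F k x0 nu z) by lra.
  apply (nonneg_of_positive_crossing (fun z => c - angle F k x0 nu z)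
    (fun z => - prufer F k nu z (angle F k x0 nu z)) a T); [| lra | | exact Hz].
  - intros t _. rewrite <- (Rminus_0_l (prufer _ _ _ _ _)).
    apply (is_derive_minus (fun _ => c) (angle F k x0 nu));
      [apply (is_derive_const (V := R_NormedModule)) | apply (angle_derive F b m M); assumption].
  - intros t Ht H. replace (angle F k x0 nu t) with c by lra.
    assert (Hs := cos_sqr c). rewrite Hc in Hs.
    unfold prufer. rewrite Hc.
    replace (sin c ^ 2) with 1 by (simpl in *; lra).
    replace (- (k * (/ F t * 0 ^ 2 - potential F nu t * 1))) with (k * potential F nu t) by ring.
    apply Rmult_lt_0_compat; [exact Hk | apply Hw, Ht].
Qed.

Lemma angle_rotation (F : R -> R) (b m M k x0 nu a c mu : R) :
  even_radius F b m M -> 0 < k -> a <= c ->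
  (forall z, a <= z <= c -> mu <= / F z /\ mu <= - potential F nu z) ->
  k * mu * (c - a) <= angle F k x0 nu c - angle F k x0 nu a.
Proof.
  intros HF Hk Hac Hmu.
  apply (increment_ge (angle F k x0 nu) (fun z => prufer F k nu z (angle F k x0 nu z))).
  - exact Hac.
  - intros z _. apply (angle_derive F b m M); assumption.
  - intros z Hz. destruct (Hmu z Hz) as [H1 H2]. unfold prufer.
    apply Rmult_le_compat_l; [lra|]. rewrite cos_sqr.
    assert (Hs := sin_sqr_bounds (angle F k x0 nu z)). nra.
Qed.

(** The angle at [PI] depends continuously on [nu].  For [nu = 1 / (2 M ^ 2)]
    the potential is positive everywhere and the angle never passes [PI / 2].
    For [nu = 1 / 2] it is negative on [[a, c]], where [F >= 2], and there the
    angle turns by at least [PI] once [k] is large.  In between the angle at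
    [PI] is exactly [PI], which is the Dirichlet condition for [u]. *)
Lemma shooting (F : R -> R) (b m M k x0 a c : R) :
  even_radius F b m M -> 1 <= M -> 0 < k -> 0 <= x0 <= PI / 2 ->
  0 <= a -> a <= c -> c <= PI -> (forall z, a <= z <= c -> 2 <= F z) ->
  PI <= k * Rmin (/ M) (1 / 2) * (c - a) ->
  exists nu, / (2 * M ^ 2) <= nu <= 1 / 2 /\ angle F k x0 nu PI = PI.
Proof.
  intros HF HM Hk Hx0 Ha Hac Hc HF2 Hrot. assert (Hpi := PI_RGT_0).
  assert (HM2 : 1 <= M ^ 2) by (simpl; nra).
  assert (Hnu0 : / (2 * M ^ 2) <= 1 / 2).
  { replace (1 / 2) with (/ 2) by lra. apply Rinv_le_contravar; lra. }
  assert (Hlow : angle F k x0 (/ (2 * M ^ 2)) PI <= PI / 2).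
  { apply (angle_stays_below F b m M k x0 _ 0 (PI / 2) PI HF Hk cos_PI2);
      [| rewrite angle_0; lra | lra].
    intros z _. unfold potential.
    destruct (radius_inv_bounds F b m M z HF) as [_ [_ HFz]].
    assert (Hb := radius_bounds _ _ _ _ HF z).
    replace (/ F z - / (2 * M ^ 2) * F z) with ((2 * M ^ 2 - F z ^ 2) / (2 * M ^ 2 * F z))
      by (field; lra).
    apply Rdiv_lt_0_compat; [simpl; nra | apply Rmult_lt_0_compat; lra]. }
  assert (Hhigh : PI <= angle F k x0 (1 / 2) PI).
  { apply (angle_stays_above F b m M k x0 (1 / 2) c PI PI HF Hk sin_PI); [|lra].
    assert (H0 : 0 <= angle F k x0 (1 / 2) a).
    { apply (angle_stays_above F b m M k x0 (1 / 2) 0 0 a HF Hk sin_0); [|lra].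
      rewrite angle_0. lra. }
    assert (H := angle_rotation F b m M k x0 (1 / 2) a c (Rmin (/ M) (1 / 2)) HF Hk Hac).
    assert (H' : k * Rmin (/ M) (1 / 2) * (c - a)
                 <= angle F k x0 (1 / 2) c - angle F k x0 (1 / 2) a); [|lra].
    apply H. intros z Hz. destruct (radius_inv_bounds F b m M z HF) as [HiM _].
    assert (H1 := Rmin_l (/ M) (1 / 2)). assert (H2 := Rmin_r (/ M) (1 / 2)).
    split; [lra|]. unfold potential.
    assert (HFz := HF2 z Hz).
    assert (/ F z <= / 2) by (apply Rinv_le_contravar; lra). lra. }
  destruct (IVT_gen (fun nu => angle F k x0 nu PI) (/ (2 * M ^ 2)) (1 / 2) PI) as [nu [Hnu Heq]].
  - apply continuity_of_continuous. intros nu.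
    apply (angle_continuous_nu F b m M); try assumption. lra.
  - rewrite Rmin_left, Rmax_right by lra. lra.
  - rewrite Rmin_left, Rmax_right in Hnu by lra. exists nu. split; assumption.
Qed.

(** The radius [rho] of the polar coordinates, from
    [rho' / rho = k (1 / F + potential) sin cos]. *)
Definition amplitude (F : R -> R) (k x0 nu z : R) : R :=
  exp (RInt (fun s => k * (/ F s + potential F nu s) *
    (sin (angle F k x0 nu s) * cos (angle F k x0 nu s))) 0 z).

Lemma amplitude_derive (F : R -> R) (b m M k x0 nu z : R) :
  even_radius F b m M -> 0 < k ->
  is_derive (amplitude F k x0 nu) z
    (k * (/ F z + potential F nu z) * (sin (angle F k x0 nu z) * cos (angle F k x0 nu z))
     * amplitude F k x0 nu z).
Proof.
  intros HF Hk.
  apply (is_derive_comp exp (fun z => RInt _ 0 z) z); [apply is_derive_exp|].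
  apply (is_derive_primitive (fun s => k * (/ F s + potential F nu s) *
    (sin (angle F k x0 nu s) * cos (angle F k x0 nu s)))).
  intros s. destruct (continuous_potential F b m M nu s HF) as [Hp Hq].
  assert (Ha := angle_derive F b m M k x0 nu s HF Hk).
  apply (continuous_mult (fun s => k * (/ F s + potential F nu s))
    (fun s => sin (angle F k x0 nu s) * cos (angle F k x0 nu s))).
  - apply (continuous_scal_r k (fun s => / F s + potential F nu s)).
    apply (continuous_plus (fun s => / F s) (potential F nu)); assumption.
  - apply (ex_derive_continuous (V := R_NormedModule)). auto_derive.
    repeat split; eexists; exact Ha.
Qed.

Lemma prufer_mode (F : R -> R) (b m M k x0 nu : R) :
  even_radius F b m M -> 0 < k ->
  mode F k nu (fun z => amplitude F k x0 nu z * sin (angle F k x0 nu z))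
              (fun z => amplitude F k x0 nu z * cos (angle F k x0 nu z)).
Proof.
  intros HF Hk.
  split; intros z;
    assert (Ha := angle_derive F b m M k x0 nu z HF Hk);
    assert (Hr := amplitude_derive F b m M k x0 nu z HF Hk);
    (auto_derive; [repeat split; eexists; eassumption|]);
    rewrite (Derive_eta _ _ _ Ha), (Derive_eta _ _ _ Hr); unfold prufer;
    set (s := sin _); set (c := cos _);
    assert (Hcs : c ^ 2 = 1 - s ^ 2) by apply cos_sqr.
  - replace (k * / F z * (amplitude F k x0 nu z * c))
      with (k * / F z * (amplitude F k x0 nu z * c) * (s ^ 2 + c ^ 2)) by (rewrite Hcs; ring).
    ring.
  - replace (k * potential F nu z * (amplitude F k x0 nu z * s))
      with (k * potential F nu z * (amplitude F k x0 nu z * s) * (s ^ 2 + c ^ 2))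
      by (rewrite Hcs; ring).
    ring.
Qed.

(** The bound [1 / 8] is below [4 / 5 - (1 / 2) (5 / 4) = 7 / 40]. *)
Lemma potential_barrier (F : R -> R) (nu z : R) :
  nu <= 1 / 2 -> 0 < F z <= 5 / 4 -> 1 / 8 <= potential F nu z /\ 1 / 2 <= / F z.
Proof.
  intros Hnu HFz.
  assert (Hi : / (5 / 4) <= / F z) by (apply Rinv_le_contravar; lra).
  unfold potential. assert (nu * F z <= 1 / 2 * (5 / 4)) by nra. lra.
Qed.

(** The condition at [- PI] comes from the reflection symmetry; the signs on
    [[0, d]] hold because the angle cannot leave [[0, PI / 2]] in the barrier. *)
Lemma dirichlet_mode (F : R -> R) (b m M k x0 nu d : R) :
  even_radius F b m M -> 0 < k -> nu <= 1 / 2 -> 0 <= x0 <= PI / 2 ->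
  (forall x, sin (2 * x0 - x) ^ 2 = sin x ^ 2) ->
  angle F k x0 nu PI = PI ->
  (forall z, 0 <= z <= d -> F z <= 5 / 4) ->
  exists u v, mode F k nu u v /\ u 0 = sin x0 /\ v 0 = cos x0 /\
    u PI = 0 /\ u (- PI) = 0 /\ (forall z, 0 <= z <= d -> 0 <= u z /\ 0 <= v z).
Proof.
  intros HF Hk Hnu Hx0 Hsym Hpi Hd.
  assert (Hpi0 := PI_RGT_0).
  assert (Hamp : forall z, 0 < amplitude F k x0 nu z) by (intros z; apply exp_pos).
  assert (Hamp0 : amplitude F k x0 nu 0 = 1).
  { unfold amplitude. rewrite (RInt_point (V := R_CompleteNormedModule)). apply exp_0. }
  assert (Hrange : forall z, 0 <= z <= d -> 0 <= angle F k x0 nu z <= PI / 2).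
  { intros z Hz. split.
    - apply (angle_stays_above F b m M k x0 nu 0 0 d HF Hk sin_0); [rewrite angle_0|]; lra.
    - apply (angle_stays_below F b m M k x0 nu 0 (PI / 2) d HF Hk cos_PI2);
        [| rewrite angle_0; lra | exact Hz].
      intros t Ht. destruct (radius_inv_bounds F b m M t HF) as [_ [_ HFt]].
      destruct (potential_barrier F nu t Hnu) as [Hw _]; [|lra].
      split; [exact HFt | apply Hd, Ht]. }
  exists (fun z => amplitude F k x0 nu z * sin (angle F k x0 nu z)),
         (fun z => amplitude F k x0 nu z * cos (angle F k x0 nu z)).
  split; [apply (prufer_mode F b m M); assumption|].
  rewrite !angle_0, Hamp0, !Rmult_1_l, Hpi, sin_PI, Rmult_0_r.
  repeat split; try reflexivity.
  - rewrite (angle_reflect F b m M), Hpi by (try assumption; lra).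
    assert (H := Hsym PI). rewrite sin_PI, pow_i, <- Rsqr_pow2 in H by lia.
    rewrite (Rsqr_0_uniq _ H). ring.
  - apply Rmult_le_pos; [left; apply Hamp|]. apply sin_ge_0; apply Hrange in H; lra.
  - apply Rmult_le_pos; [left; apply Hamp|]. apply cos_ge_0; apply Hrange in H; lra.
Qed.

(** The exponential growth in the barrier, away from the curve.  The product
    [w = u v] satisfies [w' >= (k / 8) (u ^ 2 + v ^ 2)]: the right-hand side is at
    least [k / 8] and at least [(k / 4) w].  The first bound makes [w] at
    least [k d / 32] at [d / 4], the second one makes it exponentially large on
    [[d / 2, d]], and
    [(u ^ 2)' = 2 (k / F) w] transfers this to [u] on [[3 d / 4, d]].  Using
    [w] treats even and odd initial data alike. *)
Lemma mode_growth (F : R -> R) (b m M k nu d : R) (u v : R -> R) :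
  even_radius F b m M -> 0 < k -> nu <= 1 / 2 -> 0 < d ->
  (forall z, 0 <= z <= d -> F z <= 5 / 4) ->
  mode F k nu u v -> u 0 ^ 2 + v 0 ^ 2 = 1 ->
  (forall z, 0 <= z <= d -> 0 <= u z /\ 0 <= v z) ->
  forall z, 3 * d / 4 <= z <= d ->
  k ^ 2 * (d ^ 2 / 128) * exp (k * d / 16) <= u z ^ 2.
Proof.
  intros HF Hk Hnu Hd HFd [Hu Hv] H0 Hpos z Hz.
  assert (Hcoef : forall z, 0 <= z <= d -> 1 / 8 <= potential F nu z /\ 1 / 2 <= / F z).
  { intros t Ht. apply potential_barrier; [exact Hnu|].
    destruct (radius_inv_bounds F b m M t HF) as [_ [_ HFt]].
    split; [exact HFt | apply HFd, Ht]. }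
  set (w := fun z => u z * v z).
  set (dw := fun z => k * (/ F z * v z ^ 2 + potential F nu z * u z ^ 2)).
  assert (Hw : forall z, is_derive w z (dw z)).
  { intros t. unfold w. auto_derive.
    - repeat split; eexists; [apply Hu | apply Hv].
    - rewrite (Derive_eta _ _ _ (Hu t)), (Derive_eta _ _ _ (Hv t)). unfold dw. ring. }
  assert (Hdw : forall t, 0 <= t <= d -> k / 8 * (u t ^ 2 + v t ^ 2) <= dw t).
  { intros t Ht. destruct (Hcoef t Ht) as [H1 H2]. unfold dw.
    assert (Hu2 := pow2_ge_0 (u t)). assert (Hv2 := pow2_ge_0 (v t)).
    replace (k / 8 * (u t ^ 2 + v t ^ 2)) with (k * (1 / 8 * v t ^ 2 + 1 / 8 * u t ^ 2)) by field.
    apply Rmult_le_compat_l; [lra|]. apply Rplus_le_compat; apply Rmult_le_compat_r; lra. }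
  assert (Hener : forall t, 0 <= t <= d -> 1 <= u t ^ 2 + v t ^ 2).
  { intros t Ht.
    assert (H := increment_ge (fun z => u z ^ 2 + v z ^ 2)
      (fun z => 2 * (k * (/ F z + potential F nu z) * w z)) 0 t 0 (proj1 Ht)).
    enough (0 * (t - 0) <= u t ^ 2 + v t ^ 2 - (u 0 ^ 2 + v 0 ^ 2)) by lra.
    apply H.
    - intros y _. auto_derive.
      + repeat split; eexists; [apply Hu | apply Hv].
      + rewrite (Derive_eta _ _ _ (Hu y)), (Derive_eta _ _ _ (Hv y)). unfold w. ring.
    - intros y Hy. destruct (Hcoef y ltac:(lra)). destruct (Hpos y ltac:(lra)).
      apply Rmult_le_pos; [lra|]. apply Rmult_le_pos; [apply Rmult_le_pos; lra|].
      apply Rmult_le_pos; assumption. }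
  assert (Hw4 : k * d / 32 <= w (d / 4)).
  { assert (H := increment_ge w dw 0 (d / 4) (k / 8) ltac:(lra) (fun t _ => Hw t)).
    assert (Hw0 : 0 <= w 0) by (destruct (Hpos 0 ltac:(lra)); apply Rmult_le_pos; assumption).
    enough (k / 8 * (d / 4 - 0) <= w (d / 4) - w 0) by lra.
    apply H. intros t Ht. specialize (Hdw t ltac:(lra)). specialize (Hener t ltac:(lra)).
    eapply Rle_trans; [|exact Hdw]. nra. }
  assert (Hw2 : forall t, d / 2 <= t <= d -> k * d / 32 * exp (k * d / 16) <= w t).
  { intros t Ht.
    assert (H := exp_growth_ge w dw (d / 4) t (k / 4) ltac:(lra) (fun t _ => Hw t)).
    eapply Rle_trans; [|apply H].
    - apply Rmult_le_compat; [nra | left; apply exp_pos | exact Hw4 |].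
      apply exp_le. nra.
    - intros y Hy. specialize (Hdw y ltac:(lra)). eapply Rle_trans; [|exact Hdw].
      unfold w. assert (Hsq := pow2_ge_0 (u y - v y)). nra. }
  set (lb := k ^ 2 * (d / 32) * exp (k * d / 16)).
  assert (Hlb : 0 < lb).
  { unfold lb. apply Rmult_lt_0_compat; [|apply exp_pos].
    apply Rmult_lt_0_compat; [apply pow_lt, Hk | lra]. }
  assert (H := increment_ge (fun z => u z ^ 2) (fun z => 2 * (k * / F z * w z))
    (d / 2) z lb ltac:(lra)).
  assert (Hu2 : lb * (z - d / 2) <= u z ^ 2 - u (d / 2) ^ 2).
  { apply H.
    - intros y _. auto_derive.
      + eexists; apply Hu.
      + rewrite (Derive_eta _ _ _ (Hu y)). unfold w. ring.
    - intros y Hy. specialize (Hw2 y ltac:(lra)).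
      destruct (Hcoef y ltac:(lra)) as [_ Hi].
      replace lb with (2 * (k * (1 / 2) * (k * d / 32 * exp (k * d / 16))))
        by (unfold lb; field).
      apply Rmult_le_compat_l; [lra|].
      assert (0 < exp (k * d / 16)) by apply exp_pos.
      apply Rmult_le_compat; [lra | | | exact Hw2].
      + apply Rmult_le_pos; [nra | lra].
      + apply Rmult_le_compat_l; lra. }
  assert (Hsq := pow2_ge_0 (u (d / 2))).
  replace (k ^ 2 * (d ^ 2 / 128) * exp (k * d / 16)) with (lb * (d / 4)) by (unfold lb; field).
  assert (lb * (d / 4) <= lb * (z - d / 2)) by (apply Rmult_le_compat_l; lra).
  lra.
Qed.

(** * Separated eigenfunctions on the surface of revolution *)

Definition separated (u : R -> R) (k z theta : R) : R := u z * cos (k * theta).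

Lemma mode_scal (F : R -> R) (k nu s : R) (u v : R -> R) :
  mode F k nu u v -> mode F k nu (fun z => s * u z) (fun z => s * v z).
Proof.
  intros [Hu Hv]. split; intros z.
  - replace (k * / F z * (s * v z)) with (s * (k * / F z * v z)) by ring.
    apply (is_derive_scal u), Hu.
  - replace (k * potential F nu z * (s * u z)) with (s * (k * potential F nu z * u z)) by ring.
    apply (is_derive_scal v), Hv.
Qed.

Lemma cos_freq_period (n : nat) (x : R) : cos (INR n * (x + 2 * PI)) = cos (INR n * x).
Proof.
  replace (INR n * (x + 2 * PI)) with (INR n * x + 2 * INR n * PI) by ring.
  apply cos_period.
Qed.

Lemma is_RInt_cos_sqr (n : nat) (a c : R) :
  (1 <= n)%nat ->
  is_RInt (fun theta => (a * cos (INR n * theta)) ^ 2 * c) 0 (2 * PI) (a ^ 2 * c * PI).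
Proof.
  intros Hn. assert (Hk : 0 < INR n) by (apply lt_0_INR; lia).
  set (P := fun t => a ^ 2 * c * (t / 2 + sin (INR n * t) * cos (INR n * t) / (2 * INR n))).
  assert (Hs : sin (INR n * (2 * PI)) = 0).
  { replace (INR n * (2 * PI)) with (0 + 2 * INR n * PI) by ring.
    rewrite sin_period. apply sin_0. }
  replace (a ^ 2 * c * PI) with (P (2 * PI) - P 0).
  - apply (is_RInt_derive P).
    + intros t _. unfold P. auto_derive; [exact I|].
      assert (Hc := cos_sqr (INR n * t)).
      field_simplify; [|lra]. rewrite Hc. field. lra.
    + intros t _. apply (ex_derive_continuous (V := R_NormedModule)). auto_derive. exact I.
  - unfold P. rewrite Hs, Rmult_0_r, sin_0. field. lra.
Qed.

Lemma vol_density_warped (r : R -> R) (z theta : R) :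
  0 < r z -> vol_density (warped_metric r) z theta = r z.
Proof.
  intros Hr. unfold vol_density, det_g. simpl.
  replace (1 * (r z * (r z * 1)) - 0 * (0 * 1)) with (r z ^ 2) by ring.
  apply sqrt_pow2. lra.
Qed.

Lemma d_z_separated (u : R -> R) (k z theta l : R) :
  is_derive u z l -> d_z (separated u k) z theta = l * cos (k * theta).
Proof.
  intros Hu. unfold d_z, partial_derive, separated. simpl.
  rewrite Derive_scal_l. f_equal. apply is_derive_unique, Hu.
Qed.

Lemma d_theta_separated (u : R -> R) (k z theta : R) :
  d_theta (separated u k) z theta = u z * (- k * sin (k * theta)).
Proof.
  unfold d_theta, partial_derive, separated. simpl.
  rewrite Derive_scal. f_equal. apply is_derive_unique, is_derive_cos_freq.
Qed.

(** Since [F u' = k v], the [z] part of the divergence is the derivative of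
    [k v], which the mode equation gives. *)
Lemma laplace_separated (r F : R -> R) (b m M k nu z theta : R) (u v : R -> R) :
  even_radius F b m M -> (forall z, - PI <= z <= PI -> F z = r z) ->
  mode F k nu u v -> - PI < z < PI ->
  - laplace_beltrami (warped_metric r) (separated u k) z theta
    = k ^ 2 * nu * separated u k z theta.
Proof.
  intros HF HFr [Hu Hv] Hz.
  assert (Hr : forall x, - PI < x < PI -> 0 < r x).
  { intros x Hx. rewrite <- HFr by lra. apply (radius_inv_bounds F b m M x HF). }
  unfold laplace_beltrami.
  set (A := d_z _ z theta). set (B := d_theta _ z theta).
  assert (HA : A = k * cos (k * theta) * (k * potential F nu z * u z)).
  { unfold A, d_z at 1, partial_derive. simpl.
    rewrite <- (is_derive_unique _ _ _ (Hv z)), <- (Derive_scal v).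
    apply Derive_ext_loc, (locally_of_interval (- PI) PI); [exact Hz|].
    intros x Hx. rewrite vol_density_warped by (apply Hr, Hx).
    rewrite (d_z_separated u k x theta _ (Hu x)), HFr by lra.
    unfold det_g. simpl. specialize (Hr x Hx). field. lra. }
  assert (HB : B = - (k ^ 2 * u z / r z * cos (k * theta))).
  { unfold B, d_theta at 1, partial_derive. simpl.
    rewrite (Derive_ext _ (fun y => - (k * u z / r z) * sin (k * y))).
    - rewrite Derive_scal, (Derive_eta (fun t => sin (k * t)) _ _ (is_derive_sin_freq k theta)).
      unfold Rdiv. ring.
    - intros y. rewrite vol_density_warped by (apply Hr, Hz).
      rewrite d_theta_separated. unfold det_g. simpl. specialize (Hr z Hz). field. lra. }
  rewrite HA, HB, vol_density_warped by (apply Hr, Hz).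
  unfold potential, separated. rewrite HFr by lra. specialize (Hr z Hz). field. lra.
Qed.

Lemma smooth_separated (F : R -> R) (b m M nu : R) (n : nat) (u v : R -> R) :
  even_radius F b m M -> mode F (INR n) nu u v -> smooth_on_M (separated u (INR n)).
Proof.
  intros HF [Hu Hv].
  assert (HD := open_between (- b) b).
  assert (HFs := radius_smooth _ _ _ _ HF).
  assert (Hc : forall c, smooth_on (fun x => - b < x < b) (fun _ => c))
    by (intros c i; apply diff_on_const, HD).
  assert (Hi : smooth_on (fun x => - b < x < b) (fun z => / F z)).
  { intros i. apply diff_on_inv; [exact HD | | apply HFs].
    intros x _. assert (H := radius_inv_bounds F b m M x HF). lra. }
  assert (Hs : smooth_on (fun x => - b < x < b) u).
  { apply (diff_on_system _ u v (fun z => INR n * / F z) (fun z => INR n * potential F nu z)).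
    - exact HD.
    - intros i. apply diff_on_mult; [exact HD | apply Hc | apply Hi].
    - intros i. apply diff_on_mult; [exact HD | apply Hc |].
      apply (diff_on_ext _ _ (fun z => / F z + - nu * F z)); [exact HD | |].
      + intros x _. unfold potential. ring.
      + apply diff_on_plus; [exact HD | apply Hi |].
        apply diff_on_mult; [exact HD | apply Hc | apply HFs].
    - intros x _. apply Hu.
    - intros x _. apply Hv. }
  split.
  - intros z theta _. unfold separated. rewrite cos_freq_period. reflexivity.
  - assert (Hb := radius_b _ _ _ _ HF).
    exists (mkposreal (b - PI) ltac:(lra)), (separated u (INR n)). simpl.
    split; [|reflexivity].
    intros z theta Hz i.
    apply (ex_diff_n_prod (fun x => - b < x < b) (fun _ => True));
      [lra | exact I | apply Hs | apply smooth_cos_freq].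
Qed.

Lemma continuous_density (F : R -> R) (b m M : R) (u : R -> R) :
  even_radius F b m M -> (forall z, continuous u z) ->
  forall z, continuous (fun z => u z ^ 2 * F z) z.
Proof.
  intros HF Hu z.
  apply (continuous_mult (fun z => u z ^ 2) F); [|apply (radius_cont _ _ _ _ HF)].
  apply (continuous_comp u (fun x => x ^ 2)); [apply Hu|].
  apply (ex_derive_continuous (V := R_NormedModule)). auto_derive. exact I.
Qed.

Lemma continuous_mode (F : R -> R) (k nu : R) (u v : R -> R) :
  mode F k nu u v -> forall z, continuous u z.
Proof. intros [Hu _] z. eapply is_derive_continuous, Hu. Qed.

(** The angular factor contributes [PI] to the squared norm. *)
Lemma L2norm_M_separated (r F : R -> R) (b m M : R) (n : nat) (u : R -> R) :
  even_radius F b m M -> (forall z, - PI <= z <= PI -> F z = r z) -> (1 <= n)%nat ->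
  (forall z, continuous u z) ->
  L2norm_M (warped_metric r) (separated u (INR n))
    = sqrt (PI * RInt (fun z => u z ^ 2 * F z) (- PI) PI).
Proof.
  intros HF HFr Hn Hu. assert (Hpi := PI_RGT_0).
  unfold L2norm_M. f_equal.
  rewrite <- (RInt_scal (V := R_CompleteNormedModule)).
  2: { apply (ex_RInt_continuous (V := R_CompleteNormedModule)). intros z _.
       apply (continuous_density F b m M u HF Hu). }
  apply RInt_ext. intros z Hz. rewrite Rmin_left, Rmax_right in Hz by lra.
  rewrite (RInt_ext _ (fun theta => (u z * cos (INR n * theta)) ^ 2 * F z)).
  - rewrite (is_RInt_unique _ _ _ _ (is_RInt_cos_sqr n (u z) (F z) Hn)).
    unfold scal; simpl; unfold mult; simpl. ring.
  - intros theta _. rewrite vol_density_warped.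
    + rewrite HFr by lra. reflexivity.
    + rewrite <- HFr by lra. apply (radius_inv_bounds F b m M z HF).
Qed.

Lemma L2norm_Sigma_cos (r : R -> R) (n : nat) (a : R) :
  r 0 = 1 -> (1 <= n)%nat ->
  L2norm_Sigma (warped_metric r) (fun theta => a * cos (INR n * theta)) = Rabs a * sqrt PI.
Proof.
  intros Hr Hn. assert (Hpi := PI_RGT_0).
  unfold L2norm_Sigma. simpl g_tt. rewrite Hr, !Rmult_1_r, sqrt_1.
  rewrite (is_RInt_unique _ _ _ _ (is_RInt_cos_sqr n a 1 Hn)).
  rewrite Rmult_1_r, sqrt_mult by (try apply pow2_ge_0; lra).
  rewrite <- Rsqr_pow2, sqrt_Rsqr_abs. reflexivity.
Qed.

(** Only the part of the barrier where the mode is already exponentially large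
    is kept in the integral. *)
Lemma mode_mass (F : R -> R) (b m M k nu d : R) (u v : R -> R) :
  even_radius F b m M -> 0 < k -> nu <= 1 / 2 -> 0 < d <= PI ->
  (forall z, 0 <= z <= d -> F z <= 5 / 4) ->
  mode F k nu u v -> u 0 ^ 2 + v 0 ^ 2 = 1 ->
  (forall z, 0 <= z <= d -> 0 <= u z /\ 0 <= v z) ->
  k ^ 2 * (m * d ^ 3 / 512) * exp (k * d / 16)
    <= RInt (fun z => u z ^ 2 * F z) (- PI) PI.
Proof.
  intros HF Hk Hnu Hd HFd Hmode H0 Hpos. assert (Hpi := PI_RGT_0).
  set (f := fun z => u z ^ 2 * F z).
  assert (Hfc : forall z, continuous f z).
  { apply (continuous_density F b m M u HF), (continuous_mode F k nu u v Hmode). }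
  assert (Hex : forall a c, ex_RInt f a c).
  { intros a c. apply (ex_RInt_continuous (V := R_CompleteNormedModule)). intros z _. apply Hfc. }
  assert (Hf0 : forall z, 0 <= f z).
  { intros z. apply Rmult_le_pos; [apply pow2_ge_0|].
    assert (H := radius_inv_bounds F b m M z HF). lra. }
  rewrite <- (RInt_Chasles f (- PI) (3 * d / 4) PI), <- (RInt_Chasles f (3 * d / 4) d PI)
    by apply Hex.
  assert (H1 : 0 <= RInt f (- PI) (3 * d / 4)).
  { apply RInt_ge_0; [lra | apply Hex | intros; apply Hf0]. }
  assert (H2 : 0 <= RInt f d PI).
  { apply RInt_ge_0; [lra | apply Hex | intros; apply Hf0]. }
  set (lb := k ^ 2 * (d ^ 2 / 128) * exp (k * d / 16) * m).
  assert (H3 : RInt (fun _ => lb) (3 * d / 4) d <= RInt f (3 * d / 4) d).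
  { apply RInt_le; [lra | apply ex_RInt_const | apply Hex |].
    intros z Hz. unfold lb, f.
    apply Rmult_le_compat.
    - apply Rmult_le_pos; [|left; apply exp_pos].
      apply Rmult_le_pos; [apply pow2_ge_0|]. assert (H := pow2_ge_0 d). lra.
    - left. apply (radius_m _ _ _ _ HF).
    - apply (mode_growth F b m M k nu d u v); try assumption; lra.
    - apply (radius_bounds _ _ _ _ HF). }
  rewrite RInt_const in H3. unfold scal in H3; simpl in H3; unfold mult in H3; simpl in H3.
  unfold plus; simpl.
  replace (k * (k * 1) * (m * (d * (d * (d * 1))) / 512) * exp (k * d / 16))
    with ((d - 3 * d / 4) * lb) by (unfold lb; field).
  lra.
Qed.

(** One statement for both symmetries: [x0 = PI / 2] gives even modes, with
    Cauchy data [(s, 0)] on the curve, and [x0 = 0] gives odd modes, with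
    Cauchy data [(0, s n)].  The last bound, where [s] is the normalising
    factor, controls both kinds of data. *)
Lemma concentrated_eigenfunctions (r : R -> R) :
  smooth_on_interval (- PI) PI r ->
  (forall z, - PI <= z <= PI -> 0 < r z) ->
  (forall z, - PI <= z <= PI -> r z = r (- z)) ->
  r 0 = 1 -> 2 < r (PI / 2) ->
  exists (C c l : R) (n0 : nat), 0 < C /\ 0 < c /\ 0 < l /\
  forall n, (n0 <= n)%nat -> (1 <= n)%nat /\
  forall x0, 0 <= x0 <= PI / 2 -> (forall x, sin (2 * x0 - x) ^ 2 = sin x ^ 2) ->
  exists (lambda s : R) (u : R -> R),
    l * INR n <= lambda /\
    normalized_dirichlet_eigenfunction (warped_metric r) lambda (separated u (INR n)) /\
    u 0 = s * sin x0 /\ is_derive u 0 (s * (INR n * cos x0)) /\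
    Rabs s * INR n * sqrt PI <= C * exp (- c * lambda).
Proof.
  intros Hsmooth Hpos Heven Hr0 Hrmid. assert (Hpi := PI_RGT_0).
  destruct (radius_extension r Hsmooth Hpos Heven) as [F [b [m [M [HF HFr]]]]].
  assert (HF0 : F 0 = 1) by (rewrite HFr by lra; exact Hr0).
  assert (Hm := radius_m _ _ _ _ HF).
  assert (HM : 1 <= M) by (assert (H := radius_bounds _ _ _ _ HF 0); lra).
  destruct (proj1 (continuous_eps F 0) (radius_cont _ _ _ _ HF 0) (1 / 4) ltac:(lra))
    as [d0 [Hd0 HFd0]].
  destruct (proj1 (continuous_eps F (PI / 2)) (radius_cont _ _ _ _ HF (PI / 2))
    (F (PI / 2) - 2)) as [e0 [He0 HFe0]]; [rewrite HFr; lra|].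
  set (d := Rmin (d0 / 2) PI). set (e := Rmin (e0 / 2) (PI / 2)).
  assert (Hd : 0 < d <= PI) by (split; [apply Rmin_glb_lt; lra | apply Rmin_r]).
  assert (Hd' : d <= d0 / 2) by apply Rmin_l.
  assert (He : 0 < e <= PI / 2) by (split; [apply Rmin_glb_lt; lra | apply Rmin_r]).
  assert (He' : e <= e0 / 2) by apply Rmin_l.
  assert (HFd : forall z, 0 <= z <= d -> F z <= 5 / 4).
  { intros z Hz. specialize (HFd0 z ltac:(apply Rabs_def1; lra)).
    apply Rabs_def2 in HFd0. lra. }
  assert (HFe : forall z, PI / 2 - e <= z <= PI / 2 + e -> 2 <= F z).
  { intros z Hz. specialize (HFe0 z ltac:(apply Rabs_def1; lra)).
    apply Rabs_def2 in HFe0. lra. }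
  (* At speed [k mu], the angle must make a half turn over the length [2 e]. *)
  set (mu := Rmin (/ M) (1 / 2)).
  assert (Hmu : 0 < mu) by (apply Rmin_glb_lt; [apply Rinv_0_lt_compat|]; lra).
  destruct (nfloor_ex (PI / (mu * (2 * e)))) as [n1 Hn1].
  { apply Rdiv_le_0_compat; [lra | apply Rmult_lt_0_compat; lra]. }
  set (K := m * d ^ 3 / 512).
  assert (HK : 0 < K).
  { unfold K. apply Rdiv_lt_0_compat; [|lra].
    apply Rmult_lt_0_compat; [exact Hm | apply pow_lt; lra]. }
  exists (/ sqrt K), (d / 32), (sqrt (/ (2 * M ^ 2))), (S n1).
  assert (HM2 : 0 < / (2 * M ^ 2)).
  { apply Rinv_0_lt_compat. assert (H := pow_lt M 2 ltac:(lra)). lra. }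
  split; [apply Rinv_0_lt_compat, sqrt_lt_R0, HK|].
  split; [lra|]. split; [apply sqrt_lt_R0, HM2|].
  intros n Hn. split; [lia|]. intros x0 Hx0 Hsym.
  assert (Hk1 : 1 <= INR n) by (apply (le_INR 1 n); lia).
  assert (Hkn : INR n1 + 1 <= INR n) by (rewrite <- S_INR; apply le_INR, Hn).
  set (k := INR n) in *.
  assert (Hrot : PI <= k * mu * (PI / 2 + e - (PI / 2 - e))).
  { replace PI with (PI / (mu * (2 * e)) * (mu * (2 * e))) at 1 by (field; lra).
    replace (k * mu * (PI / 2 + e - (PI / 2 - e))) with (k * (mu * (2 * e))) by ring.
    apply Rmult_le_compat_r; [apply Rmult_le_pos|]; lra. }
  destruct (shooting F b m M k x0 (PI / 2 - e) (PI / 2 + e) HF HM)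
    as [nu [Hnu Hang]]; try lra; [exact HFe | exact Hrot |].
  destruct (dirichlet_mode F b m M k x0 nu d HF) as [u [v [Hmode [Hu0 [Hv0 [HuP [HuN Huv]]]]]]];
    try assumption; try lra.
  assert (Hsc : u 0 ^ 2 + v 0 ^ 2 = 1).
  { rewrite Hu0, Hv0, cos_sqr. ring. }
  set (J := RInt (fun z => u z ^ 2 * F z) (- PI) PI).
  assert (HJ : k ^ 2 * K * exp (k * d / 16) <= J)
    by (apply (mode_mass F b m M k nu d u v); try assumption; lra).
  assert (Hk2 : 0 < k ^ 2) by (apply pow_lt; lra).
  assert (HJ1 : 0 < k ^ 2 * K * exp (k * d / 16)).
  { apply Rmult_lt_0_compat; [apply Rmult_lt_0_compat; assumption | apply exp_pos]. }
  set (N := sqrt (PI * J)).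
  assert (HN : 0 < N) by (apply sqrt_lt_R0, Rmult_lt_0_compat; lra).
  assert (Hmode' := mode_scal F k nu (/ N) u v Hmode).
  exists (k * sqrt nu), (/ N), (fun z => / N * u z).
  split.
  { rewrite Rmult_comm. apply Rmult_le_compat_l; [lra|]. apply sqrt_le_1; lra. }
  split; [|split; [|split]].
  - split; [|split; [|split]].
    + apply (smooth_separated F b m M nu n _ _ HF Hmode').
    + intros z theta Hz.
      rewrite (laplace_separated r F b m M k nu z theta _ _ HF HFr Hmode' Hz).
      rewrite Rpow_mult_distr, pow2_sqrt by lra. ring.
    + unfold k. rewrite (L2norm_M_separated r F b m M n _ HF HFr); [| lia |
        apply (continuous_mode _ _ _ _ _ Hmode')].
      assert (HRI : RInt (fun z => (/ N * u z) ^ 2 * F z) (- PI) PI = (/ N) ^ 2 * J).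
      { unfold J. symmetry. rewrite <- (RInt_scal (V := R_CompleteNormedModule)).
        - apply RInt_ext. intros z _. unfold scal; simpl; unfold mult; simpl. ring.
        - apply (ex_RInt_continuous (V := R_CompleteNormedModule)). intros z _.
          apply (continuous_density F b m M u HF), (continuous_mode F k nu u v Hmode). }
      rewrite HRI, pow_inv. unfold N. rewrite pow2_sqrt by (apply Rmult_le_pos; lra).
      rewrite <- sqrt_1. f_equal. field. lra.
    + intros theta. unfold separated. rewrite HuP, HuN. split; ring.
  - rewrite Hu0. reflexivity.
  - replace (/ N * (k * cos x0)) with (k * / F 0 * (/ N * v 0)).
    + apply (proj1 Hmode').
    + rewrite HF0, Hv0. field. lra.
  - rewrite Rabs_pos_eq by (left; apply Rinv_0_lt_compat, HN).
    assert (HsJ : k * sqrt K * exp (k * d / 32) <= sqrt J).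
    { replace (k * sqrt K * exp (k * d / 32)) with (sqrt (k ^ 2 * K * exp (k * d / 16))).
      - apply sqrt_le_1; lra.
      - replace (exp (k * d / 16)) with (exp (k * d / 32) ^ 2).
        + rewrite !sqrt_mult, !sqrt_pow2; try reflexivity; try apply pow2_ge_0; try lra.
          * left; apply exp_pos.
          * apply Rmult_le_pos; lra.
        + simpl. rewrite Rmult_1_r, <- exp_plus. f_equal. field. }
    assert (HsK : 0 < sqrt K) by (apply sqrt_lt_R0, HK).
    assert (HsP : 0 < sqrt PI) by (apply sqrt_lt_R0, Hpi).
    assert (HsJ0 : 0 < sqrt J) by (apply sqrt_lt_R0; lra).
    assert (Hexp := exp_pos (k * d / 32)).
    apply Rle_trans with (/ sqrt K * exp (- (k * d / 32))).
    + rewrite exp_Ropp, <- Rinv_mult. unfold N. rewrite sqrt_mult by lra.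
      replace (/ (sqrt PI * sqrt J) * k * sqrt PI) with (/ (sqrt J / k)) by (field; lra).
      apply Rinv_le_contravar; [apply Rmult_lt_0_compat; assumption|].
      apply Rmult_le_reg_r with k; [lra|].
      replace (sqrt J / k * k) with (sqrt J) by (field; lra). lra.
    + apply Rmult_le_compat_l; [left; apply Rinv_0_lt_compat, HsK|].
      (* decay in [k] is decay in the eigenfrequency, since [k * sqrt nu <= k] *)
      apply exp_le.
      assert (Hsn : sqrt nu <= 1) by (rewrite <- sqrt_1; apply sqrt_le_1; lra).
      assert (H : k * sqrt nu <= k * 1) by (apply Rmult_le_compat_l; lra).
      nra.
Qed.

Theorem proposition1p8
  (r : R -> R)
  (r_smooth : smooth_on_interval (- PI) PI r)
  (r_pos : forall z, - PI <= z <= PI -> 0 < r z)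
  (r_even : forall z, - PI <= z <= PI -> r z = r (- z))
  (r_0 : r 0 = 1)
  (r_mid : r (PI / 2) = sqrt 5)
  (r_end : r PI = 1 / sqrt 2) :
  exists C c : R, 0 < C /\ 0 < c /\
  exists (lambda_e lambda_o : nat -> R) (phi_e phi_o : nat -> R -> R -> R),
    is_lim_seq lambda_e p_infty /\
    is_lim_seq lambda_o p_infty /\
    (forall j : nat,
       normalized_dirichlet_eigenfunction (warped_metric r) (lambda_e j) (phi_e j) /\
       (forall theta, d_z (phi_e j) 0 theta = 0) /\
       L2norm_Sigma (warped_metric r) (fun theta => phi_e j 0 theta)
         <= C * exp (- c * lambda_e j)) /\
    (forall j : nat,
       normalized_dirichlet_eigenfunction (warped_metric r) (lambda_o j) (phi_o j) /\
       (forall theta, phi_o j 0 theta = 0) /\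
       L2norm_Sigma (warped_metric r) (fun theta => d_z (phi_o j) 0 theta)
         <= C * exp (- c * lambda_o j)).
Proof.
  assert (Hpi := PI_RGT_0).
  destruct (concentrated_eigenfunctions r r_smooth r_pos r_even r_0)
    as [C [c [l [n0 [HC [Hc [Hl Hfam]]]]]]].
  { rewrite r_mid. replace 2 with (sqrt (2 ^ 2)) by (apply sqrt_pow2; lra).
    apply sqrt_lt_1; lra. }
  exists C, c. split; [exact HC|]. split; [exact Hc|].
  assert (Hlim : forall lam : nat -> R, (forall j, l * INR (n0 + j) <= lam j) ->
    is_lim_seq lam p_infty).
  { intros lam Hlam. apply (is_lim_seq_le_p_loc (fun j => l * INR j)).
    - exists 0%nat. intros j _. eapply Rle_trans; [|apply Hlam].
      apply Rmult_le_compat_l; [lra|]. apply le_INR. lia.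
    - replace p_infty with (Rbar_mult l p_infty).
      + apply is_lim_seq_scal_l, is_lim_seq_INR.
      + apply is_Rbar_mult_unique, is_Rbar_mult_sym, is_Rbar_mult_p_infty_pos. exact Hl. }
  assert (He : forall j, exists p : R * (R -> R -> R), l * INR (n0 + j) <= fst p /\
    normalized_dirichlet_eigenfunction (warped_metric r) (fst p) (snd p) /\
    (forall theta, d_z (snd p) 0 theta = 0) /\
    L2norm_Sigma (warped_metric r) (fun theta => snd p 0 theta) <= C * exp (- c * fst p)).
  { intros j. destruct (Hfam (n0 + j)%nat ltac:(lia)) as [Hn Hx].
    destruct (Hx (PI / 2)) as [lam [s [u [Hlam [Heig [Hu0 [Hdu Hs]]]]]]]; [lra | |].
    { intros x. replace (2 * (PI / 2) - x) with (PI - x) by field.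
      rewrite sin_PI_x. reflexivity. }
    exists (lam, separated u (INR (n0 + j))). simpl.
    split; [exact Hlam|]. split; [exact Heig|]. split.
    - intros theta. rewrite (d_z_separated u _ 0 theta _ Hdu), cos_PI2. ring.
    - unfold separated. rewrite (L2norm_Sigma_cos r (n0 + j) (u 0) r_0 Hn).
      rewrite Hu0, sin_PI2, Rmult_1_r. eapply Rle_trans; [|exact Hs].
      apply Rmult_le_compat_r; [apply sqrt_pos|].
      assert (H1 : 1 <= INR (n0 + j)) by (apply (le_INR 1); lia).
      assert (H2 := Rabs_pos s). nra. }
  assert (Ho : forall j, exists p : R * (R -> R -> R), l * INR (n0 + j) <= fst p /\
    normalized_dirichlet_eigenfunction (warped_metric r) (fst p) (snd p) /\
    (forall theta, snd p 0 theta = 0) /\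
    L2norm_Sigma (warped_metric r) (fun theta => d_z (snd p) 0 theta) <= C * exp (- c * fst p)).
  { intros j. destruct (Hfam (n0 + j)%nat ltac:(lia)) as [Hn Hx].
    destruct (Hx 0) as [lam [s [u [Hlam [Heig [Hu0 [Hdu Hs]]]]]]]; [lra | |].
    { intros x. replace (2 * 0 - x) with (- x) by ring. rewrite sin_neg. ring. }
    exists (lam, separated u (INR (n0 + j))). simpl.
    split; [exact Hlam|]. split; [exact Heig|]. split.
    - intros theta. unfold separated. rewrite Hu0, sin_0. ring.
    - rewrite cos_0, Rmult_1_r in Hdu.
      assert (Heq : L2norm_Sigma (warped_metric r)
          (fun theta => d_z (separated u (INR (n0 + j))) 0 theta)
        = L2norm_Sigma (warped_metric r)
            (fun theta => s * INR (n0 + j) * cos (INR (n0 + j) * theta))).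
      { unfold L2norm_Sigma. f_equal. apply RInt_ext. intros theta _.
        rewrite (d_z_separated u _ 0 theta _ Hdu). reflexivity. }
      rewrite Heq, (L2norm_Sigma_cos r (n0 + j) _ r_0 Hn), Rabs_mult.
      rewrite (Rabs_pos_eq (INR (n0 + j))) by apply pos_INR. exact Hs. }
  apply functional_choice in He. destruct He as [fe He].
  apply functional_choice in Ho. destruct Ho as [fo Ho].
  exists (fun j => fst (fe j)), (fun j => fst (fo j)),
         (fun j => snd (fe j)), (fun j => snd (fo j)).
  split; [apply Hlim; intros j; apply He|].
  split; [apply Hlim; intros j; apply Ho|].
  split; intros j; [apply He | apply Ho].
Qed.
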